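(* Let $r>0$, let $I\subseteq\mathbb{R}$ be an interval, $D\subseteq\mathbb{R}$ an open set, $I-r=\{y-r: y\in I\}$, and let $F$ be a smooth real-valued function on $I\times D\times (I-r)\times D^{4}$. Consider the second order neutral differential equation $$x''(t)=F\bigl(t,x(t),t-r,x(t-r),x'(t),x'(t-r),x''(t-r)\bigr).$$ Suppose this equation is invariant under a one-parameter Lie group $\bar t=t+\delta\,\omega(t,x)+O(\delta^2)$, $\bar x=x+\delta\,\Upsilon(t,x)+O(\delta^2)$ with smooth infinitesimals $\omega,\Upsilon$. Then, along solutions $x$ of the equation, the following (Lie type invariance condition) holds: $$\omega F_{t}+\Upsilon F_{x}+\omega^{r}F_{t-r}+\Upsilon^{r}F_{x(t-r)}+\Upsilon_{[t]}F_{x'(t)}+\Upsilon_{[t]}^{r}F_{x'(t-r)}+\Upsilon_{[tt]}^{r}F_{x''(t-r)}$$ $$=\Upsilon_{tt}+(2\Upsilon_{tx}-\omega_{tt})x'+(\Upsilon_{xx}-2\omega_{tx})x'^{2}-\omega_{xx}x'^{3}+(\Upsilon_{x}-2\omega_{t})x''-3\omega_{x}x'x''.$$ Here $\omega,\Upsilon$ and their derivatives are evaluated at $(t,x(t))$; $x',x''$ mean $x'(t),x''(t)$; $\omega^r=\omega(t-r,x(t-r))$, $\Upsilon^r=\Upsilon(t-r,x(t-r))$; $$\Upsilon_{[t]}=\Upsilon_t+(\Upsilon_x-\omega_t)x'-\omega_x x'^2 ;$$ $\Upsilon_{[t]}^{r}$ is the expression $$\Upsilon_t+(\Upsilon_x-\omega_t)x'(t-r)-\omega_x\,x'(t-r)^2$$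 and $\Upsilon_{[tt]}^{r}$ is the expression $$\Upsilon_{tt}+(2\Upsilon_{tx}-\omega_{tt})x'(t-r)+(\Upsilon_{xx}-2\omega_{tx})x'(t-r)^{2}-\omega_{xx}x'(t-r)^{3}+(\Upsilon_{x}-2\omega_{t})x''(t-r)-3\omega_{x}x'(t-r)x''(t-r),$$ where in the last two expressions all partial derivatives of $\omega$ and $\Upsilon$ are evaluated at $(t-r,x(t-r))$.
   Context: The partial derivatives $F_t,F_x,F_{t-r},F_{x(t-r)},F_{x'(t)},F_{x'(t-r)},F_{x''(t-r)}$ are the partial derivatives of $F$ with respect to its seven arguments, in the order $(t,x,t-r,x(t-r),x'(t),x'(t-r),x''(t-r))$, evaluated along the solution. A one-parameter Lie group is a family of transformations $\bar t=f_1(t,x;\delta)$, $\bar x=f_2(t,x;\delta)$ with $f_1,f_2$ smooth in $(t,x)$, having convergent Taylor series in $\delta$, equal to the identity at $\delta=0$, with inverse given by the parameter $-\delta$, and with composition of the parameters $\delta$ and $\epsilon$ given by $\delta+\epsilon$. Its infinitesimals are $\omega(t,x)=\partial f_1/\partial\delta\,(t,x;0)$ and $\Upsilon(t,x)=\partial f_2/\partial\delta\,(t,x;0)$. The delayed variables are transformed by the same group: $\overline{t-r}=t-r+\delta\,\omega(t-r,x(t-r))+O(\delta^2)$ and $\overline{x(t-r)}=x(t-r)+\delta\,\Upsilon(t-r,x(t-r))+O(\delta^2)$. Derivatives are transformed by the chain rule along the curve: $\frac{d\bar x}{d\bar t}=\frac{d\bar x/dt}{d\bar t/dt}$ and $\frac{d^2\bar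 x}{d\bar t^2}=\frac{d(d\bar x/d\bar t)/dt}{d\bar t/dt}$; the transformed delayed derivatives $\frac{d\bar x}{d\bar t}(\overline{t-r})$ and $\frac{d^2\bar x}{d\bar t^2}(\overline{t-r})$ are the same expressions at the point $t-r$ of the curve. The equation is invariant under the group if for every solution $x$ and all small $\delta$, $$\frac{d^{2}\bar{x}}{d\bar{t}^{2}}=F\Bigl(\bar{t},\bar{x},\overline{t-r},\overline{x(t-r)},\tfrac{d\bar{x}}{d\bar{t}},\tfrac{d\bar{x}}{d\bar{t}}(\overline{t-r}),\tfrac{d^{2}\bar{x}}{d\bar{t}^{2}}(\overline{t-r})\Bigr).$$ *)

(* Defs.v *)
From HB Require Import structures.
From mathcomp Require Import all_boot all_order all_algebra.
From mathcomp Require Import all_classical all_reals all_analysis.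
Set Implicit Arguments.
Unset Strict Implicit.
Unset Printing Implicit Defensive.
Import Order.TTheory GRing.Theory Num.Theory.
Import numFieldNormedType.Exports.
Local Open Scope classical_set_scope.
Local Open Scope ring_scope.

Section Calculus.
Variables (R : realType) (V : normedModType R).

(* The library's [derivable] and ['D_v f a], except that the increments [h]
   are restricted to those that keep the point inside [A]: at a boundary point
   of an interval this is the one-sided derivative. *)
Definition derivable_in (A : set V) (f : V -> R) (a v : V) : Prop :=
  cvg ((fun h : R => h^-1 * (f (h *: v + a) - f a))
         @ within [set h | A (h *: v + a)] 0^').

Definition derive_in (A : set V) (f : V -> R) (a v : V) : R :=
  lim ((fun h : R => h^-1 * (f (h *: v + a) - f a))
         @ within [set h | A (h *: v + a)] 0^').

(* C^oo on an open set: iterated directional derivatives of every order, in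
   arbitrary directions, are Frechet differentiable there. *)
Definition smooth_open (U : set V) (f : V -> R) : Prop :=
  forall (vs : seq V) (p : V), U p ->
    differentiable (foldr (fun v g => fun q => 'D_v g q) f vs) p.

(* Smoothness on a set that need not be open: local smooth extendability. *)
Definition smooth_on (A : set V) (f : V -> R) : Prop :=
  forall p, A p -> exists (U : set V) (G : V -> R),
    [/\ open U, U p, smooth_open U G & forall q, U q -> A q -> G q = f q].

End Calculus.

Section Groups.
Variable R : realType.

Definition analytic_at (g : R -> R) (d0 : R) : Prop :=
  exists a : nat -> R, \forall h \near (0 : R), pseries a h @ \oo --> g (d0 + h).

(* A (local) one-parameter transformation group on the open plane set [M]:
   [W] is the open set of those ((t, x), d) at which the transformation with
   parameter [d] is defined. [M] and [W] may be everything (global group). *)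
Record one_parameter_group (M : set (R * R)) (W : set (R * R * R))
    (f1 f2 : R * R -> R -> R) : Prop := OneParameterGroup {
  group_open_space : open M ;
  group_open_domain : open W ;
  group_domain_sub : forall p d, W (p, d) -> M p ;
  group_maps : forall p d, W (p, d) -> M (f1 p d, f2 p d) ;
  group_smooth : forall d,
    smooth_open [set p | W (p, d)] (f1 ^~ d) /\
    smooth_open [set p | W (p, d)] (f2 ^~ d) ;
  group_analytic : forall p d, W (p, d) ->
    analytic_at (f1 p) d /\ analytic_at (f2 p) d ;
  group_id : forall p, M p -> W (p, 0) /\ (f1 p 0, f2 p 0) = p ;
  group_inv : forall p d, W (p, d) ->
    let q := (f1 p d, f2 p d) in
    W (q, - d) /\ (f1 q (- d), f2 q (- d)) = p ;
  group_comp : forall p d e,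
    let q := (f1 p d, f2 p d) in
    W (p, d) -> W (q, e) -> W (p, d + e) ->
    (f1 q e, f2 q e) = (f1 p (d + e), f2 p (d + e)) }.

Definition pt (g : R * R -> R) (p : R * R) : R := 'D_((1, 0) : R * R) g p.
Definition px (g : R * R -> R) (p : R * R) : R := 'D_((0, 1) : R * R) g p.

(* The coefficients [Ups_[t]] and [Ups_[tt]] of the prolonged infinitesimal
   generator at the point [p], with [y1], [y2] in place of x', x''. *)
Definition prolong1 (omega Ups : R * R -> R) (p : R * R) (y1 : R) : R :=
  pt Ups p + (px Ups p - pt omega p) * y1 - px omega p * y1 ^+ 2.

Definition prolong2 (omega Ups : R * R -> R) (p : R * R) (y1 y2 : R) : R :=
  pt (pt Ups) p + (2 * px (pt Ups) p - pt (pt omega) p) * y1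
  + (px (px Ups) p - 2 * px (pt omega) p) * y1 ^+ 2
  - px (px omega) p * y1 ^+ 3
  + (px Ups p - 2 * pt omega p) * y2
  - 3 * px omega p * y1 * y2.

End Groups.

Section DelayEquation.
Variable R : realType.

Definition shift_set (I : set R) (r : R) : set R := [set y - r | y in I].

(* I `|` (I - r), the set on which a solution has to be defined. *)
Definition sol_set (I : set R) (r : R) : set R := I `|` shift_set I r.

Definition arg_type : normedModType R := (R * R * R * R * R * R * R)%type.

Definition eq_dom (r : R) (I D : set R) : set arg_type :=
  I `*` D `*` shift_set I r `*` D `*` D `*` D `*` D.

Definition der (J : set R) (y : R -> R) (t : R) : R := derive_in J y t 1.

Definition sol_args (r : R) (J : set R) (x : R -> R) (t : R) : arg_type :=
  (t, x t, t - r, x (t - r), der J x t, der J x (t - r),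
   der J (der J x) (t - r)).

Definition solution (r : R) (I D : set R) (F : arg_type -> R)
    (x : R -> R) : Prop :=
  let J := sol_set I r in
  (forall s, J s -> derivable_in J x s 1 /\ derivable_in J (der J x) s 1) /\
  (forall t, I t -> eq_dom r I D (sol_args r J x t) /\
                    der J (der J x) t = F (sol_args r J x t)).

(* dX/dT along the parametrized curve s |-> (T s, X s). *)
Definition curve_der (J : set R) (T X : R -> R) (t : R) : R :=
  der J X t / der J T t.

Definition curve_args (r : R) (J : set R) (T X : R -> R) (t : R) : arg_type :=
  let X1 := curve_der J T X in
  let X2 := curve_der J T X1 in
  (T t, X t, T (t - r), X (t - r), X1 t, X1 (t - r), X2 (t - r)).

(* "All small d" may depend on the solution and on t, and the transformed
   identity is only required where F is defined. *)
Definition invariant_under (r : R) (I D : set R) (F : arg_type -> R)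
    (f1 f2 : R * R -> R -> R) : Prop :=
  let J := sol_set I r in
  forall x, solution r I D F x -> forall t, I t -> \forall d \near (0 : R),
    let T := fun s => f1 (s, x s) d in
    let X := fun s => f2 (s, x s) d in
    eq_dom r I D (curve_args r J T X t) ->
    curve_der J T (curve_der J T X) t = F (curve_args r J T X t).

Definition partial_in (A : set arg_type) (F : arg_type -> R) (e a : arg_type) : R :=
  derive_in A F a e.

Definition e_t   : arg_type := (1, 0, 0, 0, 0, 0, 0).
Definition e_x   : arg_type := (0, 1, 0, 0, 0, 0, 0).
Definition e_tr  : arg_type := (0, 0, 1, 0, 0, 0, 0).
Definition e_xr  : arg_type := (0, 0, 0, 1, 0, 0, 0).
Definition e_x1  : arg_type := (0, 0, 0, 0, 1, 0, 0).
Definition e_x1r : arg_type := (0, 0, 0, 0, 0, 1, 0).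
Definition e_x2r : arg_type := (0, 0, 0, 0, 0, 0, 1).

End DelayEquation.

(* Main.v *)
Require Import Defs.
From HB Require Import structures.
From mathcomp Require Import all_boot all_order all_algebra.
From mathcomp Require Import all_classical all_reals all_analysis.
From mathcomp Require Import ring lra.
Import Order.TTheory GRing.Theory Num.Theory.
Import numFieldNormedType.Exports.
Local Open Scope classical_set_scope.
Local Open Scope ring_scope.
Set Implicit Arguments.
Unset Strict Implicit.
Unset Printing Implicit Defensive.

(** At an interior point t of I, differentiate the transformed equation at d = 0
    by the chain rule. This needs the d-derivatives at 0 of the transformed curve
    and of its first two derivatives along the curve. The group is only assumed
    smooth in (t, x) for fixed d and analytic in d for fixed (t, x), so exchanging
    the two kinds of derivative is not free: the group law turns d |-> f p d into
    an orbit of the vector field V = (omega, Ups), and comparing neighbouring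
    orbits (V is strictly differentiable) shows that the derivative along the curve
    solves the linearized equation. Applying the same comparison to the orbit
    paired with its derivative gives the second order.

    At an endpoint of I the transformed point may leave the domain of F for every
    small d <> 0, so that invariance says nothing there. But x'', being a
    derivative, has the Darboux property, so t is a limit of interior points along
    which all arguments of F converge, and the condition passes to the limit. *)

(** * Short-time growth of curves in a normed space *)

Section FlowBounds.
Context {R : realType}.

(** Neither a Gronwall estimate nor a uniqueness theorem for differential equations is needed: on a
    short parameter range, speed times time already confines the orbits. What matters is the order
    of the choices. The range of d is fixed before the neighbouring orbit tends to the reference
    one, because the division by their distance takes place at a fixed d.

    The comparison is stated in an arbitrary normed space so that one lemma serves both the field V
    on the plane and its linearization (p, v) -> (V p, DV p v) on pairs. The second use requires the
    linearized equation at every small d and at neighbouring points of the curve, not only at d = 0;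
    a translation of the parameter supplies it.

    The passage to an endpoint needs the condition as the vanishing of a continuous function of the
    argument tuple. For this, F is replaced by a local smooth extension G, and the second derivative
    at t by the value of G. *)

Lemma is_derive_epsP (E : normedModType R) (f : R -> E) (a : R) (l : E) :
  is_derive a 1 f l <->
  forall e, 0 < e -> \forall s \near a,
    `|f s - f a - (s - a) *: l| <= e * `|s - a|.
Proof.
split=> [fl e e0|H].
  have /derivable_nbhs := @ex_derive _ _ _ _ _ _ _ fl.
  rewrite derive_val => /eqaddoP /(_ e e0) H.
  rewrite (near_shift 0)/= subr0.
  near=> h; have : `|f (h *: 1 + a) - (f a + h *: l)| <= e * `|h| by near: h.
  by rewrite /= addrK {1}/GRing.scale /= mulr1 opprD addrA.
have fl : h^-1 *: (f (h *: (1 : R) + a) - f a) @[h --> 0^'] --> l.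
  apply/cvgrPdist_le => e e0.
  have := H e e0; rewrite (near_shift 0)/= subr0 => He.
  near=> h.
  have h0 : h != 0 by near: h; exact: nbhs_dnbhs_neq.
  have : `|f (h + a) - f a - (h + a - a) *: l| <= e * `|h + a - a|.
    near: h; apply: nbhs_dnbhs; exact: He.
  rewrite addrK => Heh.
  rewrite (_ : h *: 1 = h); last by rewrite /GRing.scale /= mulr1.
  have -> : l - h^-1 *: (f (h + a) - f a) = - (h^-1 *: (f (h + a) - f a - h *: l)).
    by rewrite [in RHS]scalerBr scalerA mulVf// scale1r opprB.
  by rewrite normrN normrZ normfV ler_pdivrMl ?normr_gt0// mulrC.
split; first by apply/cvg_ex; exists l.
exact: cvg_lim fl.
Unshelve. all: by end_near. Qed.

(** A mean value inequality by a supremum argument, valid in any normed space. The speed is bounded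
    only inside the ball, so confinement and growth have to be proved together: as long as the
    estimate holds up to [s], the curve is inside the ball, its speed at [s] is at most [C], and the
    estimate extends past [s]. *)
Lemma growth_bound_right (E : normedModType R) (g g' : R -> E) (C rho delta : R) :
  0 <= C -> C * delta < rho ->
  (forall d : R, 0 <= d < delta -> is_derive d 1 g (g' d)) ->
  (forall d : R, 0 <= d < delta -> `|g d - g 0| < rho -> `|g' d| <= C) ->
  forall d : R, 0 <= d < delta -> `|g d - g 0| <= C * d.
Proof.
move=> C0 Cd gd gb d /andP[]; rewrite le_eqVlt => /predU1P[<- _|d0 dd].
  by rewrite subrr normr0 mulr0.
have Cdr : C * d < rho by apply: le_lt_trans Cd; rewrite ler_wpM2l// ltW.
(* A slope [B] larger than [C] leaves room to step past the supremum. The excess [m] keeps [B * d]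
   below [rho] and is at most the arbitrary [e]. *)
suff H B : C < B -> B * d < rho -> `|g d - g 0| <= B * d.
  apply/ler_addgt0Pr => e e0.
  pose m := Num.min e ((rho - C * d) / 2).
  have m0 : 0 < m by rewrite lt_min e0/= divr_gt0// subr_gt0.
  have me : m <= e by rewrite ge_min lexx.
  have mr : m <= (rho - C * d) / 2 by rewrite ge_min lexx orbT.
  have E1 : (C + m / d) * d = C * d + m by rewrite mulrDl divfK// gt_eqF.
  apply: le_trans (H (C + m / d) _ _) _.
  - by rewrite ltrDl divr_gt0.
  - rewrite E1; move: mr m0; lra.
  - by rewrite E1 lerD2l.
move=> CB Bd.
pose S := [set s : R | 0 <= s <= d /\ forall u : R, 0 <= u <= s -> `|g u - g 0| <= B * u].
have S0 : S 0.
  split; first by rewrite lexx ltW.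
  by move=> u; rewrite -eq_le => /eqP<-; rewrite subrr normr0 mulr0.
have Sub : ubound S d by move=> s [/andP[]].
have hS : has_sup S by split; [exists 0|exists d].
pose s := sup S.
have s0 : 0 <= s by apply: ub_le_sup => //; exists d.
have sd : s <= d by apply: ge_sup => //; exists 0.
have sdel : 0 <= s < delta by rewrite s0/=; exact: le_lt_trans dd.
have ltS u : 0 <= u -> u < s -> `|g u - g 0| <= B * u.
  move=> u0 us; have [v [vd Hv] uv] := sup_gt (ex_intro _ 0 S0) us.
  by apply: Hv; rewrite u0 ltW.
have B0 : 0 < B by exact: le_lt_trans CB.
have gs := gd s sdel; move/is_derive_epsP : (gs) => gse.
have atS : `|g s - g 0| <= B * s.
  have gcont : {for s, continuous g}.
    by apply/differentiable_continuous/derivable1_diffP.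
  move: s0; rewrite le_eqVlt => /predU1P[<-|s0].
    by rewrite subrr normr0 mulr0.
  apply/ler_addgt0Pr => e e0.
  have {}gcont : \forall u \near s, `|g s - g u| < e.
    by move/cvgrPdist_lt : gcont => /(_ e e0).
  have /nbhs_ballP[r /= r0 Hr] := gcont.
  pose u : R := Num.max 0 (s - r / 2).
  have u0 : 0 <= u by rewrite le_max lexx.
  have us : u < s by rewrite gt_max s0/= ltrBlDr ltrDl divr_gt0.
  have su : s - r / 2 <= u by rewrite le_max lexx orbT.
  have gu : `|g s - g u| < e.
    apply: Hr; rewrite -ball_normE /= ger0_norm ?subr_ge0 ?ltW//.
    by move: r0 su; clear; lra.
  have -> : g s - g 0 = (g s - g u) + (g u - g 0) by rewrite addrA subrK.
  apply: le_trans (ler_normD _ _) _; rewrite addrC lerD//; last exact: ltW.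
  by apply: le_trans (ltS _ u0 us) _; rewrite ler_pM2l// ltW.
have [sd'|] := ltP s d; last first.
  by move=> ds; have <- : s = d by apply/eqP; rewrite eq_le sd ds.
exfalso.
have g'C : `|g' s| <= C.
  by apply: gb => //; apply: le_lt_trans atS _; apply: le_lt_trans Bd; rewrite ler_pM2l.
(* The slack [B - C] absorbs the first-order error of [g] at [s], so just to the right of [s] the
   increments are at most [B * (u - s)]. *)
have eps0 : 0 < B - C by rewrite subr_gt0.
have /nbhs_ballP[r /= r0 Hr] := gse _ eps0.
pose v := Num.min d (s + r / 2).
have sv : s < v by rewrite lt_min sd'/= ltrDl divr_gt0.
have vd : v <= d by rewrite ge_min lexx.
have vr : v <= s + r / 2 by rewrite ge_min lexx orbT.
suff /(ub_le_sup _) : S v by move=> /(_ (ex_intro _ d Sub)); rewrite leNgt sv.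
split=> [|u /andP[u0 uv]]; first by rewrite vd (le_trans s0)// ltW.
have [us|su] := ltP u s; first exact: ltS.
have := Hr u; rewrite -ball_normE /= => /(_ _)/wrap[].
  by rewrite ltr_norml; move: r0 su uv vr; clear; lra.
move=> Hu.
have -> : g u - g 0 = (g u - g s - (u - s) *: g' s) + ((u - s) *: g' s) + (g s - g 0).
  by rewrite subrK addrA subrK.
have us0 : 0 <= u - s by rewrite subr_ge0.
apply: le_trans (ler_normD _ _) _.
have -> : B * u = B * (u - s) + B * s by ring.
apply: lerD atS; apply: le_trans (ler_normD _ _) _.
rewrite normrZ; move: Hu; rewrite (ger0_norm us0) => Hu.
have : (u - s) * `|g' s| <= (u - s) * C by rewrite ler_wpM2l.
by move: Hu; rewrite mulrBl; lra.
Unshelve. all: by end_near. Qed.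

(* The speed of g is only controlled while g stays within rho of g 0; since
   C * delta < rho, g cannot leave that ball before |d| = delta. *)
Lemma growth_bound (E : normedModType R) (g g' : R -> E) (C rho delta : R) :
  0 <= C -> C * delta < rho ->
  (forall d : R, `|d| < delta -> is_derive d 1 g (g' d)) ->
  (forall d : R, `|d| < delta -> `|g d - g 0| < rho -> `|g' d| <= C) ->
  forall d : R, `|d| < delta -> `|g d - g 0| <= C * `|d|.
Proof.
move=> C0 Cd gd gb d dd.
have [d0|d0] := leP 0 d.
  rewrite (ger0_norm d0); apply: (growth_bound_right (g' := g') C0 Cd).
  - by move=> u /andP[u0 ud]; apply: gd; rewrite ger0_norm.
  - by move=> u /andP[u0 ud]; apply: gb; rewrite ger0_norm.
  - by rewrite d0/=; move: dd; rewrite ger0_norm.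
rewrite (ltr0_norm d0).
have := @growth_bound_right E (g \o -%R) (fun u => - g' (- u)) _ _ _ C0 Cd _ _ (- d).
rewrite /= oppr0 opprK; apply.
- move=> u /andP[u0 ud].
  have : is_derive (- u) 1 g (g' (- u)) by apply: gd; rewrite normrN ger0_norm.
  move=> /is_derive_epsP H; apply/is_derive_epsP => e e0.
  have oc : continuous (-%R : R -> R) by exact: opp_continuous.
  have He := oc u _ (H e e0).
  near=> s; have : `|g (- s) - g (- u) - (- s - - u) *: g' (- u)| <= e * `|- s - - u|.
    by near: s.
  by rewrite -opprD normrN /= scaleNr -scalerN.
- move=> u /andP[u0 ud] Hu; rewrite normrN; apply: gb => //.
  by rewrite normrN ger0_norm.
- by rewrite oppr_ge0 (ltW d0)/=; move: dd; rewrite ltr0_norm.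
Unshelve. all: by end_near. Qed.

End FlowBounds.

(** * Strict differentiability and variation of orbits *)

Section StrictDifferentiability.
Context {R : realType}.

(** The strict (or strong) derivative: both points vary near [p]. An ordinary derivative at [p]
    would not do, since the two orbits to be compared both move away from [p]. [L] is a bare
    function with explicit linearity and bound, so that derivatives on products can be given by
    formulas. *)
Record strict_diff (E F : normedModType R) (f : E -> F) (p : E) (L : E -> F) : Prop :=
  StrictDiff {
    strict_diff_linear : linear L ;
    strict_diff_bounded : exists2 K, 0 <= K & forall h, `|L h| <= K * `|h| ;
    strict_diff_eps : forall e, 0 < e -> \forall z \near (p, p),
      `|f z.1 - f z.2 - L (z.1 - z.2)| <= e * `|z.1 - z.2| }.

Lemma strict_diff_lip (E F : normedModType R) (f : E -> F) p L :
  strict_diff f p L ->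
  exists2 K, 0 <= K & (forall h, `|L h| <= K * `|h|) /\
    \forall z \near (p, p), `|f z.1 - f z.2| <= K * `|z.1 - z.2|.
Proof.
move=> [_ [K K0 LK] He]; exists (K + 1); first by rewrite addr_ge0.
split=> [h|].
  by apply: le_trans (LK h) _; rewrite ler_wpM2r// lerDl.
have := He 1 ltr01; apply: filterS => z Hz.
rewrite -(subrK (L (z.1 - z.2)) (f z.1 - f z.2)).
apply: le_trans (ler_normD _ _) _.
by rewrite addrC mulrDl lerD.
Qed.

Lemma strict_diff_continuous (E F : normedModType R) (f : E -> F) p L :
  strict_diff f p L -> {for p, continuous f}.
Proof.
move=> /strict_diff_lip[K K0 [_ H]].
have {}H : \forall a \near p, `|f p - f a| <= K * `|p - a|.
  have /nbhs_ballP[r /= r0 Hr] := H.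
  apply/nbhs_ballP; exists r => //= a pa.
  by apply: (Hr (p, a)); split => //=; exact: ballxx.
apply/cvgrPdist_lt => e e0.
have e1 : 0 < e / (K + 1) by rewrite divr_gt0// ltr_wpDl.
near=> a.
have : `|p - a| < e / (K + 1).
  by near: a; apply/nbhs_ballP; exists (e / (K + 1)) => //= a; rewrite -ball_normE.
rewrite ltr_pdivlMr ?ltr_wpDl// => pa.
have : `|f p - f a| <= K * `|p - a| by near: a.
move=> /le_lt_trans; apply; apply: le_lt_trans pa.
by rewrite mulrC ler_wpM2l// lerDl.
Unshelve. all: by end_near. Qed.

Lemma strict_diff_pair (E F G : normedModType R) (f : E -> F) (g : E -> G) p Lf Lg :
  strict_diff f p Lf -> strict_diff g p Lg ->
  strict_diff (fun a => (f a, g a)) p (fun h => (Lf h, Lg h)).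
Proof.
move=> [lf [K K0 HK] ef] [lg [N N0 HN] eg]; split.
- by move=> k u v /=; rewrite lf lg.
- exists (Num.max K N); first by rewrite le_max K0.
  move=> h; rewrite prod_normE /= ge_max; apply/andP; split.
    by apply: le_trans (HK h) _; rewrite ler_wpM2r// le_max lexx.
  by apply: le_trans (HN h) _; rewrite ler_wpM2r// le_max lexx orbT.
- move=> e e0; have := ef e e0; have := eg e e0; apply: filterS2 => z Hg Hf.
  by rewrite prod_normE /= ge_max Hf Hg.
Qed.

Lemma strict_diff_of_linear (E F : normedModType R) (L : E -> F) p :
  linear L -> (exists2 K, 0 <= K & forall h, `|L h| <= K * `|h|) ->
  strict_diff L p L.
Proof.
move=> lL bL; split => // e e0; near=> z.
have -> : L (z.1 - z.2) = L z.1 - L z.2.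
  by have := lL (-1) z.2 z.1; rewrite !scaleN1r ![- _ + _]addrC.
by rewrite subrr normr0 mulr_ge0// ltW.
Unshelve. all: by end_near. Qed.

Lemma strict_diffD (E F : normedModType R) (f g : E -> F) p Lf Lg :
  strict_diff f p Lf -> strict_diff g p Lg ->
  strict_diff (fun a => f a + g a) p (fun h => Lf h + Lg h).
Proof.
move=> [lf [K K0 HK] ef] [lg [N N0 HN] eg]; split.
- by move=> k u v /=; rewrite lf lg scalerDr addrACA.
- exists (K + N); first by rewrite addr_ge0.
  move=> h; apply: le_trans (ler_normD _ _) _.
  by rewrite mulrDl lerD.
- move=> e e0; have e2 : 0 < e / 2 by rewrite divr_gt0.
  have := ef _ e2; have := eg _ e2; apply: filterS2 => z Hg Hf.
  rewrite !opprD (addrACA (f z.1)) [X in `|X|]addrACA.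
  apply: le_trans (ler_normD _ _) _.
  by rewrite [in leRHS](splitr e) mulrDl lerD.
Qed.

Lemma strict_diffM (E : normedModType R) (f g : E -> R) p Lf Lg :
  strict_diff f p Lf -> strict_diff g p Lg ->
  strict_diff (fun a => f a * g a) p (fun h => Lf h * g p + f p * Lg h).
Proof.
move=> sf sg; have cf := strict_diff_continuous sf.
have cg := strict_diff_continuous sg.
move: sf sg => [lf [K K0 HK] ef] [lg [N N0 HN] eg]; split.
- by move=> k u v; rewrite lf lg /GRing.scale /=; ring.
- exists (K * `|g p| + `|f p| * N); first by rewrite addr_ge0// mulr_ge0.
  move=> h; apply: le_trans (ler_normD _ _) _; rewrite !normrM mulrDl lerD//.
    by rewrite mulrAC ler_wpM2r.
  by rewrite -mulrA ler_wpM2l.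
- move=> e e0.
  (* [B] is the sum of the coefficients of the four terms into which the remainder is split below;
     each term contains one factor of size [e1]. *)
  pose B := `|g p| + `|f p| + K + N + 2.
  have B0 : 0 < B by rewrite /B; do ?rewrite ltr_wpDl ?addr_ge0//.
  pose e1 := Num.min 1 (e / B).
  have e10 : 0 < e1 by rewrite lt_min ltr01 divr_gt0.
  have e11 : e1 <= 1 by rewrite ge_min lexx.
  have e1B : e1 * B <= e by rewrite -ler_pdivlMr// ge_min lexx orbT.
  have ncf : \forall z \near (p, p), `|f p - f z.2| <= e1.
    by move/cvgrPdist_le : cf => /(_ e1 e10) H; apply: (cvg_snd H).
  have ncg : \forall z \near (p, p), `|g p - g z.1| <= e1.
    by move/cvgrPdist_le : cg => /(_ e1 e10) H; apply: (cvg_fst H).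
  near=> z.
  have H1 : `|f p - f z.2| <= e1 by near: z.
  have H2 : `|g p - g z.1| <= e1 by near: z.
  have H3 : `|f z.1 - f z.2 - Lf (z.1 - z.2)| <= e1 * `|z.1 - z.2|.
    by near: z; exact: ef.
  have H4 : `|g z.1 - g z.2 - Lg (z.1 - z.2)| <= e1 * `|z.1 - z.2|.
    by near: z; exact: eg.
  move: (HK (z.1 - z.2)) (HN (z.1 - z.2)) => H5 H6.
  move: H3 H4 H5 H6; set h := z.1 - z.2; set n := `|h|.
  move=> H3 H4 H5 H6.
  have n0 : 0 <= n by exact: normr_ge0.
  have -> : f z.1 * g z.1 - f z.2 * g z.2 - (Lf h * g p + f p * Lg h) =
    (f z.1 - f z.2 - Lf h) * g z.1 + - (Lf h * (g p - g z.1))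
    + (- ((f p - f z.2) * Lg h) + f z.2 * (g z.1 - g z.2 - Lg h)) by ring.
  have G1 : `|g z.1| <= `|g p| + 1.
    rewrite -[g z.1](subKr (g p)); apply: le_trans (ler_normB _ _) _.
    by rewrite lerD2l (le_trans H2).
  have F1 : `|f z.2| <= `|f p| + 1.
    rewrite -[f z.2](subKr (f p)); apply: le_trans (ler_normB _ _) _.
    by rewrite lerD2l (le_trans H1).
  apply: (@le_trans _ _ (e1 * B * n)); last by rewrite ler_wpM2r.
  have -> : e1 * B * n = ((e1 * n) * (`|g p| + 1) + (K * n) * e1) +
    (e1 * (N * n) + (`|f p| + 1) * (e1 * n)) by rewrite /B; ring.
  have M1 : `|(f z.1 - f z.2 - Lf h) * g z.1| <= (e1 * n) * (`|g p| + 1).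
    by rewrite normrM ler_pM.
  have M2 : `|Lf h * (g p - g z.1)| <= (K * n) * e1 by rewrite normrM ler_pM.
  have M3 : `|(f p - f z.2) * Lg h| <= e1 * (N * n) by rewrite normrM ler_pM.
  have M4 : `|f z.2 * (g z.1 - g z.2 - Lg h)| <= (`|f p| + 1) * (e1 * n).
    by rewrite normrM ler_pM.
  apply: le_trans (ler_normD _ _) _; apply: lerD.
    by apply: le_trans (ler_normD _ _) _; rewrite normrN lerD.
  by apply: le_trans (ler_normD _ _) _; rewrite normrN lerD.
Unshelve. all: by end_near. Qed.

Lemma strict_diff_fst (E F G : normedModType R) (f : E -> F) (p : E * G) L :
  strict_diff f p.1 L -> strict_diff (fun a : E * G => f a.1) p (fun h => L h.1).
Proof.
move=> [lL [K K0 HK] ef]; split.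
- by move=> k u v; rewrite -lL.
- exists K => // h; apply: le_trans (HK h.1) _; rewrite ler_wpM2l//.
  by rewrite [leRHS]prod_normE /= le_max lexx.
- move=> e e0; have /nbhs_ballP[r /= r0 Hr] := ef e e0.
  apply/nbhs_ballP; exists r => //= z [[/= z1 _] [/= z2 _]].
  have /= Hz := Hr (z.1.1, z.2.1) (conj z1 z2).
  apply: le_trans Hz _; apply: ler_wpM2l; first exact: ltW.
  by rewrite [leRHS]prod_normE /= le_max lexx.
Qed.

(* The orbits c s and c t0 stay O(|s - t0|) apart, so along their difference V may
   be replaced by L up to o(|s - t0|), uniformly in d; then divide by s - t0. *)
Lemma flow_deriv (E : normedModType R) (V : E -> E) (c : R -> R -> E)
    (t0 eta : R) (L : E -> E) (v : R -> E) :
  0 < eta -> strict_diff V (c t0 0) L ->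
  (forall s d : R, `|s - t0| < eta -> `|d| < eta ->
     is_derive d 1 (c s) (V (c s d))) ->
  (forall d : R, `|d| < eta -> is_derive t0 1 (c ^~ d) (v d)) ->
  is_derive (0 : R) 1 v (L (v 0)).
Proof.
move=> eta0 [lL [K K0 HK] ef] cV cv.
have LB a b : L (a - b) = L a - L b.
  by have := lL (-1) b a; rewrite !scaleN1r ![- _ + _]addrC.
have LZ k a : L (k *: a) = k *: L a.
  have L0 : L 0 = 0 by rewrite -{1}(subrr (0 : E)) LB subrr.
  by have := lL k a 0; rewrite !addr0 L0 addr0.
apply/is_derive_epsP => e e0.
pose M := `|v 0| + 1; have M0 : 0 < M by rewrite ltr_wpDl.
(* [2 * M], 1 and [K] are the contributions of [T1], [T2] and [T3] below to the speed of the
   deviation [g]. *)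
pose B := 2 * M + K + 1.
have B0 : 0 < B by rewrite ltr_wpDl// addr_ge0// mulr_ge0// ltW.
pose e1 := Num.min 1 (e / B).
have e10 : 0 < e1 by rewrite lt_min ltr01 divr_gt0.
have e11 : e1 <= 1 by rewrite ge_min lexx.
have e1B : e1 * B <= e by rewrite -ler_pdivlMr// ge_min lexx orbT.
pose p := c t0 0.
have [rho /= rho0 Hrho] : exists2 rho, 0 < rho & forall a b,
    `|a - p| < rho -> `|b - p| < rho ->
    `|V a - V b - L (a - b)| <= e1 * `|a - b|.
  have /nbhs_ballP[rho /= rho0 H] := ef _ e10.
  exists rho => // a b ap bp; apply: (H (a, b)).
  by split => /=; rewrite -ball_normE /= distrC.
pose K1 := K + 1; have K10 : 0 < K1 by rewrite ltr_wpDl.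
have lip a b : `|a - p| < rho -> `|b - p| < rho -> `|V a - V b| <= K1 * `|a - b|.
  move=> ap bp; rewrite -(subrK (L (a - b)) (V a - V b)).
  apply: le_trans (ler_normD _ _) _; rewrite addrC mulrDl lerD// mul1r.
  by apply: le_trans (Hrho _ _ ap bp) _; rewrite ler_piMl.
have pp : `|p - p| < rho by rewrite subrr normr0.
pose C := `|V p| + K1 * rho.
have C0 : 0 < C by rewrite ltr_wpDl// mulr_gt0.
have VC a : `|a - p| < rho -> `|V a| <= C.
  move=> ap; rewrite -(subrK (V p) (V a)); apply: le_trans (ler_normD _ _) _.
  rewrite addrC lerD2l; apply: le_trans (lip _ _ ap pp) _.
  by rewrite ler_wpM2l// ltW.
(* The four bounds serve, in turn, to stay where the hypotheses hold, to keep orbits that start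
   within [rho / 2] of [p] within [rho], to let the difference of two orbits at most double its
   initial bound, and to make its drift negligible after applying [L]. None depends on [s], so [s]
   may tend to [t0] with [d] fixed. The [+ 1] covers [K = 0]. *)
pose delta := Num.min (Num.min eta (rho / (4 * C)))
                      (Num.min ((4 * K1)^-1) (e1 / (2 * K1 * M * K + 1))).
have Q0 : 0 < 2 * K1 * M * K + 1 by rewrite ltr_wpDl// !mulr_ge0// ltW.
have delta0 : 0 < delta.
  by rewrite !lt_min eta0 /= !divr_gt0 ?mulr_gt0// invr_gt0 mulr_gt0.
have [d_eta d_rho d_K1 d_e1] : [/\ delta <= eta, delta <= rho / (4 * C),
    delta <= (4 * K1)^-1 & delta <= e1 / (2 * K1 * M * K + 1)].
  by split; rewrite !ge_min lexx ?orbT.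
have Cdelta : C * delta < rho / 2.
  apply: (@le_lt_trans _ _ (rho / 4)); last by move: rho0; lra.
  have -> : rho / 4 = C * (rho / (4 * C)) by field; rewrite gt_eqF.
  by rewrite ler_wpM2l// ltW.
have stay s : `|s - t0| < eta -> `|c s 0 - p| < rho / 2 ->
    forall d, `|d| < delta -> `|c s d - p| < rho.
  move=> st cs.
  have near_rho d : `|c s d - c s 0| < rho / 2 -> `|c s d - p| < rho.
    move=> H; rewrite -(subrKA (c s 0)); apply: le_lt_trans (ler_normD _ _) _.
    by move: H cs; lra.
  move=> d dd; apply: (near_rho).
  apply: (@le_lt_trans _ _ (C * `|d|)).
    apply: (growth_bound (g' := fun d => V (c s d)) (ltW C0) Cdelta) => //.
      by move=> u ud; apply: cV => //; exact: lt_le_trans d_eta.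
    by move=> u ud /near_rho; exact: VC.
  by apply: le_lt_trans Cdelta; rewrite ler_wpM2l// ltW.
have t0eta : `|t0 - t0| < eta by rewrite subrr normr0.
have t0rho : `|c t0 0 - p| < rho / 2 by rewrite subrr normr0 divr_gt0.
have cv0 : is_derive t0 1 (c ^~ 0) (v 0) by apply: cv; rewrite normr0.
apply/nbhs_ballP; exists delta => //= d.
rewrite -ball_normE /= sub0r normrN subr0 => dd.
apply: (@le_trans _ _ (e1 * B * `|d|)); last by rewrite ler_wpM2r.
(* [e2] pays for the first-order errors in [s] at the parameters [d] and 0, half each. Since [d] is
   already fixed, one [s] close enough to [t0] suffices. *)
apply/ler_addgt0Pr => e2 e20.
pose e3 := e2 / 2; have e30 : 0 < e3 by rewrite divr_gt0.
have /is_derive_epsP H0 := cv0.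
have /is_derive_epsP Hd := cv d (lt_le_trans dd d_eta).
have cc : {for t0, continuous (c ^~ 0)}.
  by apply/differentiable_continuous/derivable1_diffP.
have : \forall s \near t0^', `|s - t0| < eta /\ `|c s 0 - p| < rho / 2 /\
   `|c s 0 - c t0 0 - (s - t0) *: v 0| <= e1 * `|s - t0| /\
   `|c s 0 - c t0 0 - (s - t0) *: v 0| <= e3 * `|s - t0| /\
   `|c s d - c t0 d - (s - t0) *: v d| <= e3 * `|s - t0| /\ s != t0.
  near=> s; split; last split; last split; last split; last split.
  - near: s; apply: nbhs_dnbhs; apply/nbhs_ballP; exists eta => //= s.
    by rewrite -ball_normE /= distrC.
  - near: s; apply: nbhs_dnbhs; move/cvgrPdist_lt : cc => /(_ (rho / 2)).
    move=> /(_ (divr_gt0 rho0 (ltr0n _ 2))); apply: filterS => s.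
    by rewrite distrC.
  - by near: s; apply: nbhs_dnbhs; exact: H0.
  - by near: s; apply: nbhs_dnbhs; exact: H0.
  - by near: s; apply: nbhs_dnbhs; exact: Hd.
  - by near: s; exact: nbhs_dnbhs_neq.
move=> /filter_ex[s [s1 [s2 [s3 [s4 [s5 s6]]]]]].
pose h := s - t0; have h0 : 0 < `|h| by rewrite normr_gt0 subr_eq0.
pose D (u : R) := c s u - c t0 u.
have DM : `|D 0| <= M * `|h|.
  rewrite /D -(subrK (h *: v 0) (c s 0 - c t0 0)).
  apply: le_trans (ler_normD _ _) _; rewrite normrZ /M mulrDl addrC.
  rewrite [X in X + _]mulrC lerD2l; apply: le_trans s3 _.
  by rewrite ler_wpM2r.
have Dder (u : R) : `|u| < delta -> is_derive u 1 D (V (c s u) - V (c t0 u)).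
  move=> ud; have ue : `|u| < eta by exact: lt_le_trans d_eta.
  by have A1 := cV _ _ s1 ue; have A2 := cV _ _ t0eta ue; exact: is_deriveB.
have D2 u : `|D u - D 0| < M * `|h| -> `|D u| <= 2 * M * `|h|.
  move=> H; rewrite -(subrK (D 0) (D u)); apply: le_trans (ler_normD _ _) _.
  by move: H DM; lra.
have C2 : K1 * (2 * M * `|h|) * delta < M * `|h|.
  have X0 : 0 < M * `|h| by rewrite mulr_gt0.
  have : K1 * delta <= 4^-1.
    have -> : 4^-1 = K1 * (4 * K1)^-1 by field; rewrite gt_eqF.
    by rewrite ler_wpM2l// ltW.
  move=> Y; have : (K1 * delta) * (M * `|h|) <= 4^-1 * (M * `|h|).
    by rewrite ler_wpM2r// ltW.
  by move: X0; lra.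
have Dgrowth u : `|u| < delta -> `|D u - D 0| <= K1 * (2 * M * `|h|) * `|u|.
  apply: (growth_bound (g' := fun u => V (c s u) - V (c t0 u)) _ C2) => //.
    by rewrite !mulr_ge0// ltW.
  move=> w wd /D2 Dw; apply: le_trans (lip _ _ _ _) _; try exact: stay.
  by rewrite ler_wpM2l// ltW.
have Dlt u : `|u| < delta -> `|D u| <= 2 * M * `|h|.
  move=> ud; apply: D2; apply: le_lt_trans (Dgrowth _ ud) _.
  by apply: le_lt_trans C2; rewrite ler_wpM2l ?ltW// !mulr_gt0.
(* The deviation of [D] from its linear prediction. Bounding its speed by [e1 * B] times the norm of
   [h] is the desired estimate before division by [h]. *)
pose g (u : R) := D u - u *: (h *: L (v 0)).
pose g' (u : R) := V (c s u) - V (c t0 u) - h *: L (v 0).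
have gder (u : R) : `|u| < delta -> is_derive u 1 g (g' u).
  move=> /Dder Du; apply: is_deriveB.
  apply/is_derive_epsP => q q0; near=> y.
  by rewrite -scalerBl subrr normr0 mulr_ge0// ltW.
have gC u : `|u| < delta -> `|g' u| <= e1 * B * `|h|.
  move=> ud.
  have -> : g' u = (V (c s u) - V (c t0 u) - L (c s u - c t0 u))
                 + (L (D u - D 0) + L (D 0 - h *: v 0)).
    by rewrite -[c s u - c t0 u]/(D u) (LB (D u)) (LB (D 0)) LZ !subrKA.
  have T1 : `|V (c s u) - V (c t0 u) - L (c s u - c t0 u)| <= e1 * (2 * M * `|h|).
    apply: le_trans (Hrho _ _ _ _) _; try exact: stay.
    by apply: ler_wpM2l; [exact: ltW|exact: Dlt].
  have T2 : `|L (D u - D 0)| <= e1 * `|h|.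
    apply: le_trans (HK _) _.
    apply: (@le_trans _ _ (K * (K1 * (2 * M * `|h|) * delta))).
      apply: ler_wpM2l => //; apply: le_trans (Dgrowth _ ud) _.
      by rewrite ler_wpM2l ?ltW// !mulr_gt0.
    have : delta * (2 * K1 * M * K + 1) <= e1 by rewrite -ler_pdivlMr.
    move=> Y; apply: (@le_trans _ _ (delta * (2 * K1 * M * K + 1) * `|h|)); last first.
      by rewrite ler_wpM2r.
    have : 0 <= delta * `|h| by rewrite mulr_ge0// ltW.
    by clear; lra.
  have T3 : `|L (D 0 - h *: v 0)| <= K * (e1 * `|h|).
    by apply: le_trans (HK _) _; rewrite ler_wpM2l.
  apply: le_trans (ler_normD _ _) _.
  have := ler_normD (L (D u - D 0)) (L (D 0 - h *: v 0)).
  by move: T1 T2 T3; rewrite /B; clear; lra.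
(* The speed of [g] is bounded on the whole range, so any large enough confinement radius will
   do. *)
have C3 : e1 * B * `|h| * delta < e1 * B * `|h| * delta + 1 by rewrite ltrDl.
have gg : `|g d - g 0| <= e1 * B * `|h| * `|d|.
  apply: (growth_bound _ C3 gder) => //; first by rewrite !mulr_ge0// ltW.
  by move=> u ud _; exact: gC.
have gE : h *: (v d - v 0 - d *: L (v 0)) =
    (g d - g 0) + - (c s d - c t0 d - h *: v d) + (c s 0 - c t0 0 - h *: v 0).
  rewrite /g scale0r subr0 /D !scalerBr !scalerA [d * h]mulrC.
  rewrite (opprB (c s d - c t0 d)).
  set X1 := c s d - c t0 d; set X2 := c s 0 - c t0 0.
  set Y := (h * d) *: _; set Z1 := h *: v d; set Z2 := h *: v 0.
  have -> : X1 - Y - X2 + (Z1 - X1) = Z1 - Y - X2.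
    by rewrite addrC -(addrA X1) subrKA addrA.
  by rewrite addrA subrK addrAC.
rewrite -(ler_pM2l h0) -normrZ gE mulrDr.
have -> : `|h| * (e1 * B * `|d|) + `|h| * e2 =
   e1 * B * `|h| * `|d| + e3 * `|h| + e3 * `|h| by rewrite /e3; field.
apply: le_trans (ler_normD _ _) _; apply: lerD => //.
by apply: le_trans (ler_normD _ _) _; rewrite normrN lerD.
Unshelve. all: by end_near. Qed.

End StrictDifferentiability.

(** * Calculus in the plane *)

Section PlaneCalculus.
Context {R : realType}.
Implicit Types (f : R * R -> R) (p : R * R).

Lemma is_derive1_comp (E F : normedModType R) (f : E -> F) (g : R -> E) (s : R) (v : E) :
  differentiable f (g s) -> is_derive s 1 g v ->
  is_derive s 1 (fun u => f (g u)) ('D_v f (g s)).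
Proof.
move=> df dg; have dg' : differentiable g s by apply/derivable1_diffP.
have dfg : differentiable (f \o g) s by exact: differentiable_comp.
split; first exact/derivable1_diffP.
rewrite deriveE// diff_comp//= deriveE//; congr ('d f (g s) _).
by rewrite -deriveE// derive_val.
Qed.

Lemma is_derive_pair (E F : normedModType R) (f : R -> E) (g : R -> F) (s : R) a b :
  is_derive s 1 f a -> is_derive s 1 g b ->
  is_derive s 1 (fun u => (f u, g u)) (a, b).
Proof.
move=> /is_derive_epsP Hf /is_derive_epsP Hg; apply/is_derive_epsP => e e0.
have := Hf e e0; have := Hg e e0; apply: filterS2 => u gu fu.
by rewrite prod_normE /= ge_max fu gu.
Qed.

Lemma is_derive_fst (E F : normedModType R) (f : R -> E * F) (s : R) l :
  is_derive s 1 f l -> is_derive s 1 (fun u => (f u).1) l.1.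
Proof.
move=> /is_derive_epsP Hf; apply/is_derive_epsP => e e0.
by have := Hf e e0; apply: filterS => u; rewrite prod_normE /= ge_max => /andP[].
Qed.

Lemma is_derive_snd (E F : normedModType R) (f : R -> E * F) (s : R) l :
  is_derive s 1 f l -> is_derive s 1 (fun u => (f u).2) l.2.
Proof.
move=> /is_derive_epsP Hf; apply/is_derive_epsP => e e0.
by have := Hf e e0; apply: filterS => u; rewrite prod_normE /= ge_max => /andP[].
Qed.

Lemma is_derive_continuous (E : normedModType R) (f : R -> E) (s : R) l :
  is_derive s 1 f l -> {for s, continuous f}.
Proof. by move=> fl; apply/differentiable_continuous/derivable1_diffP. Qed.

Lemma smooth_open_derive (V : normedModType R) (U : set V) (f : V -> R) v :
  smooth_open U f -> smooth_open U ('D_v f).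
Proof. by move=> sf vs p Up; have := sf (rcons vs v) p Up; rewrite foldr_rcons. Qed.

Lemma smooth_open_differentiable (V : normedModType R) (U : set V) (f : V -> R) (p : V) :
  smooth_open U f -> U p -> differentiable f p.
Proof. by move=> sf Up; exact: (sf [::]). Qed.

Lemma smooth_pt (M : set (R * R)) f : smooth_open M f -> smooth_open M (pt f).
Proof. exact: (@smooth_open_derive _ M f ((1 : R), (0 : R))). Qed.

Lemma smooth_px (M : set (R * R)) f : smooth_open M f -> smooth_open M (px f).
Proof. exact: (@smooth_open_derive _ M f ((0 : R), (1 : R))). Qed.

Lemma smooth_open_continuous (V : normedModType R) (U : set V) (f : V -> R) (p : V) :
  smooth_open U f -> U p -> {for p, continuous f}.
Proof.
by move=> sf Up; apply/differentiable_continuous/(smooth_open_differentiable sf).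
Qed.

Lemma deriveDv (V : normedModType R) (f : V -> R) (p : V) (u v : V) :
  differentiable f p -> 'D_(u + v) f p = 'D_u f p + 'D_v f p.
Proof. by move=> df; rewrite !deriveE// linearD. Qed.

Lemma deriveZv (V : normedModType R) (f : V -> R) (p : V) k (v : V) :
  differentiable f p -> 'D_(k *: v) f p = k * 'D_v f p.
Proof. by move=> df; rewrite !deriveE// linearZ. Qed.

Lemma derive_plane f p v :
  differentiable f p -> 'D_v f p = pt f p * v.1 + px f p * v.2.
Proof.
move=> df; rewrite mulrC [px f p * _]mulrC -!deriveZv// -deriveDv//.
congr ('D_ _ f p); case: v => v1 v2; congr pair => /=.
  by rewrite /GRing.scale /= mulr1 mulr0 addr0.
by rewrite /GRing.scale /= mulr1 mulr0 add0r.
Qed.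

Lemma is_derive_pt f (s b : R) :
  differentiable f (s, b) -> is_derive s 1 (fun u => f (u, b)) (pt f (s, b)).
Proof.
move=> df; apply: (@is_derive1_comp _ _ f (fun u : R => (u, b))) => //.
by apply: is_derive_pair; exact: is_derive_cst.
Qed.

Lemma is_derive_px f (a s : R) :
  differentiable f (a, s) -> is_derive s 1 (fun u => f (a, u)) (px f (a, s)).
Proof.
move=> df; apply: (@is_derive1_comp _ _ f (fun u : R => (a, u))) => //.
by apply: is_derive_pair; exact: is_derive_cst.
Qed.

(** The mean value theorem without an order on [u] and [v], locating the intermediate point only in
    a ball: the form that arguments moving one coordinate at a time call for. *)
Lemma MVT_ball (g g' : R -> R) (c r u v : R) :
  `|c - u| < r -> `|c - v| < r ->
  (forall w : R, `|c - w| < r -> is_derive w 1 g (g' w)) ->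
  exists2 w, `|c - w| < r & g u - g v = g' w * (u - v).
Proof.
wlog uv : u v / v <= u.
  move=> H cu cv dg; have [/H|/ltW/H] := leP v u; first exact.
  move=> /(_ cv cu dg)[w cw E]; exists w => //.
  by rewrite -opprB E -mulrN opprB.
move=> cu cv dg.
have inb w : v <= w <= u -> `|c - w| < r.
  by move=> /andP[vw wu]; move: cu cv; rewrite !ltr_norml; lra.
have [w||w] := @MVT_segment _ g g' v u uv.
- by move=> /[!in_itv]/= /andP[? ?]; apply/dg/inb; rewrite !ltW.
- apply: derivable_within_continuous => w; rewrite in_itv /= => /inb/dg.
  by case.
- by rewrite in_itv /= => /inb ?; exists w.
Qed.

(** Changing one coordinate at a time gives two exact mean value identities. Continuity of the
    partial derivatives at [p] makes the resulting error uniform in both points, hence strict and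
    not only Frechet differentiability. *)
Lemma smooth_strict_diff (M : set (R * R)) f p :
  open M -> smooth_open M f -> M p ->
  strict_diff f p (fun h => pt f p * h.1 + px f p * h.2).
Proof.
move=> oM sf Mp; split.
- by move=> k u v; rewrite /= /GRing.scale /=; ring.
- exists (`|pt f p| + `|px f p|); first by rewrite addr_ge0.
  move=> h; apply: le_trans (ler_normD _ _) _; rewrite !normrM mulrDl.
  by apply: lerD; apply: ler_wpM2l => //; rewrite prod_normE /= le_max lexx ?orbT.
- move=> e e0; have e2 : 0 < e / 2 by rewrite divr_gt0.
  have ct : \forall q \near p, `|pt f p - pt f q| <= e / 2.
    by move/cvgrPdist_le : (smooth_open_continuous (smooth_pt sf) Mp); apply.
  have cx : \forall q \near p, `|px f p - px f q| <= e / 2.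
    by move/cvgrPdist_le : (smooth_open_continuous (smooth_px sf) Mp); apply.
  have nM : nbhs p M by exact: open_nbhs_nbhs.
  have : nbhs p (fun q => (`|pt f p - pt f q| <= e / 2 /\
      `|px f p - px f q| <= e / 2) /\ M q).
    exact: (filterI (filterI ct cx) nM).
  move=> /nbhs_ballP[r /= r0 Hr].
  have {}Hr q : `|p.1 - q.1| < r -> `|p.2 - q.2| < r ->
     [/\ `|pt f p - pt f q| <= e / 2, `|px f p - px f q| <= e / 2 & M q].
    by move=> q1 q2; have [|[? ?] ?] := Hr q; first by split; rewrite -ball_normE.
  apply/nbhs_ballP; exists r => //= -[[a1 a2] [b1 b2]] [[/= a1r a2r] [/= b1r b2r]].
  rewrite -ball_normE /= in a1r; rewrite -ball_normE /= in a2r.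
  rewrite -ball_normE /= in b1r; rewrite -ball_normE /= in b2r.
  have [w1 w1r E1] : exists2 w, `|p.1 - w| < r &
      f (a1, a2) - f (b1, a2) = pt f (w, a2) * (a1 - b1).
    apply: (@MVT_ball (fun u => f (u, a2)) (fun w => pt f (w, a2)) p.1 r) => //.
    move=> w wr; apply: is_derive_pt; apply: (smooth_open_differentiable sf).
    by have [] := Hr (w, a2).
  have [w2 w2r E2] : exists2 w, `|p.2 - w| < r &
      f (b1, a2) - f (b1, b2) = px f (b1, w) * (a2 - b2).
    apply: (@MVT_ball (fun u => f (b1, u)) (fun w => px f (b1, w)) p.2 r) => //.
    move=> w wr; apply: is_derive_px; apply: (smooth_open_differentiable sf).
    by have [] := Hr (b1, w).
  have -> : f (a1, a2) - f (b1, b2) - (pt f p * (a1 - b1) + px f p * (a2 - b2)) =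
      - ((pt f p - pt f (w1, a2)) * (a1 - b1)) - (px f p - px f (b1, w2)) * (a2 - b2).
    have -> : f (a1, a2) - f (b1, b2) =
       (f (a1, a2) - f (b1, a2)) + (f (b1, a2) - f (b1, b2)) by ring.
    by rewrite E1 E2; ring.
  have [H1 _ _] := Hr (w1, a2) w1r a2r.
  have [_ H2 _] := Hr (b1, w2) b1r w2r.
  apply: le_trans (ler_normB _ _) _; rewrite normrN !normrM.
  rewrite [in leRHS](splitr e) mulrDl.
  by apply: lerD; apply: ler_pM => //; rewrite prod_normE /= le_max lexx ?orbT.
Qed.

(** The second difference [Q] over a square is evaluated by the mean value theorem in both orders.
    The two intermediate points differ, but both lie in the ball where the mixed derivatives are
    within [e / 2] of their values at the centre, so the side [h] need not tend to 0. *)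
Lemma schwarz (M : set (R * R)) (f ft fx ftx fxt : R * R -> R) (t x : R) :
  open M -> M (t, x) ->
  (forall s b : R, M (s, b) -> is_derive s 1 (fun u => f (u, b)) (ft (s, b))) ->
  (forall a s : R, M (a, s) -> is_derive s 1 (fun u => f (a, u)) (fx (a, s))) ->
  (forall a s : R, M (a, s) -> is_derive s 1 (fun u => ft (a, u)) (fxt (a, s))) ->
  (forall s b : R, M (s, b) -> is_derive s 1 (fun u => fx (u, b)) (ftx (s, b))) ->
  {for (t, x), continuous fxt} -> {for (t, x), continuous ftx} ->
  fxt (t, x) = ftx (t, x).
Proof.
move=> oM Mp dft dfx dfxt dftx /cvgrPdist_le c1 /cvgrPdist_le c2.
apply/eqP; rewrite -subr_eq0 -normr_le0; apply/ler_addgt0Pr => e e0; rewrite add0r.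
have e2 : 0 < e / 2 by rewrite divr_gt0.
have nM : nbhs (t, x) M by exact: open_nbhs_nbhs.
have : nbhs (t, x) (fun q => (`|fxt (t, x) - fxt q| <= e / 2 /\
      `|ftx (t, x) - ftx q| <= e / 2) /\ M q).
  exact: (filterI (filterI (c1 _ e2) (c2 _ e2)) nM).
move=> /nbhs_ballP[r /= r0 Hr].
have {}Hr a b : `|t - a| < r -> `|x - b| < r ->
   [/\ `|fxt (t, x) - fxt (a, b)| <= e / 2,
       `|ftx (t, x) - ftx (a, b)| <= e / 2 & M (a, b)].
  move=> q1 q2; have [|[? ?] ?] := Hr (a, b); last by split.
  by split; rewrite -ball_normE.
pose h := r / 2; have h0 : 0 < h by rewrite divr_gt0.
have th (u : R) : `|u - (u + h)| < r.
  by rewrite opprD addNKr normrN gtr0_norm// /h; move: r0; lra.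
have t0 (u : R) : `|u - u| < r by rewrite subrr normr0.
pose Q := f (t + h, x + h) - f (t + h, x) - (f (t, x + h) - f (t, x)).
have [a [b [ar br Eq]]] : exists a b,
    [/\ `|t - a| < r, `|x - b| < r & Q = fxt (a, b) * h * h].
  have [|w wr Ew] := @MVT_ball (fun s => f (s, x + h) - f (s, x))
     (fun s => ft (s, x + h) - ft (s, x)) t r (t + h) t (th t) (t0 t).
  - move=> s sr; have [_ _ M1] := Hr s (x + h) sr (th x).
    have [_ _ M2] := Hr s x sr (t0 x).
    by have D1 := dft _ _ M1; have D2 := dft _ _ M2; exact: is_deriveB.
  have [|y yr Ey] := @MVT_ball (fun s => ft (w, s))
     (fun s => fxt (w, s)) x r (x + h) x (th x) (t0 x).
  - by move=> s sr; apply: dfxt; have [] := Hr w s wr sr.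
  exists w, y; split => //.
  by rewrite /Q Ew Ey ![_ + h - _]addrAC !subrr !add0r.
have [a' [b' [ar' br' Eq']]] : exists a b,
    [/\ `|t - a| < r, `|x - b| < r & Q = ftx (a, b) * h * h].
  have [|w wr Ew] := @MVT_ball (fun s => f (t + h, s) - f (t, s))
     (fun s => fx (t + h, s) - fx (t, s)) x r (x + h) x (th x) (t0 x).
  - move=> s sr; have [_ _ M1] := Hr (t + h) s (th t) sr.
    have [_ _ M2] := Hr t s (t0 t) sr.
    by have D1 := dfx _ _ M1; have D2 := dfx _ _ M2; exact: is_deriveB.
  have [|y yr Ey] := @MVT_ball (fun s => fx (s, w))
     (fun s => ftx (s, w)) t r (t + h) t (th t) (t0 t).
  - by move=> s sr; apply: dftx; have [] := Hr s w sr wr.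
  exists y, w; split => //.
  have -> : Q = f (t + h, x + h) - f (t, x + h) - (f (t + h, x) - f (t, x)).
    by rewrite /Q; ring.
  by rewrite Ew Ey ![_ + h - _]addrAC !subrr !add0r.
have EE : fxt (a, b) = ftx (a', b').
  have hn : h != 0 by rewrite gt_eqF.
  by apply: (mulIf hn); apply: (mulIf hn); rewrite -Eq -Eq'.
have [H1 _ _] := Hr _ _ ar br; have [_ H2 _] := Hr _ _ ar' br'.
have -> : fxt (t, x) - ftx (t, x) =
   (fxt (t, x) - fxt (a, b)) - (ftx (t, x) - ftx (a', b')) by rewrite EE; ring.
apply: le_trans (ler_normB _ _) _.
by rewrite (splitr e) lerD.
Qed.

Lemma smooth_symmetric (M : set (R * R)) f p :
  open M -> smooth_open M f -> M p -> px (pt f) p = pt (px f) p.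
Proof.
move=> oM sf; case: p => t x Mp.
have st := smooth_pt sf; have sx := smooth_px sf.
apply: (@schwarz M f (pt f) (px f) (pt (px f)) (px (pt f)) t x oM Mp).
- by move=> s b Ms; apply/is_derive_pt/(smooth_open_differentiable sf).
- by move=> a s Ms; apply/is_derive_px/(smooth_open_differentiable sf).
- by move=> a s Ms; apply/is_derive_px/(smooth_open_differentiable st).
- by move=> s b Ms; apply/is_derive_pt/(smooth_open_differentiable sx).
- exact: smooth_open_continuous (smooth_px st) Mp.
- exact: smooth_open_continuous (smooth_pt sx) Mp.
Qed.

End PlaneCalculus.

(** * Orbits of a one-parameter group *)

Section GroupFlow.
Context {R : realType}.

(** For i at least 2, the i-th power of the norm of [h] is at most its square over [K ^+ 2], times
    [K ^+ i]. This quadratic remainder yields the derivative at the centre without termwise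
    differentiation. *)
Lemma power_series_tail (a : nat -> R) (K h l : R) :
  cvgn (pseries (fun i => `|a i|) K) -> 0 < K -> `|h| <= K ->
  pseries a h @ \oo --> l ->
  `|l - a 0%N - a 1%N * h| <= (`|h| / K) ^+ 2 * limn (pseries (fun i => `|a i|) K).
Proof.
move=> cK K0 hK ahl; apply/ler_addgt0Pr => e e0.
move/cvgrPdist_lt : ahl => /(_ e e0) [N _ HN].
(* Two extra terms, so that the constant and linear ones can be split off. *)
pose n := N.+2; have {}HN : `|l - pseries a h n| < e.
  by apply: HN; rewrite /= /n; do 2 apply: leqW.
have -> : l - a 0%N - a 1%N * h = (pseries a h n - a 0%N - a 1%N * h) + (l - pseries a h n).
  by ring.
apply: le_trans (ler_normD _ _) _; apply: lerD; last exact: ltW.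
have -> : pseries a h n - a 0%N - a 1%N * h = \sum_(0 <= i < N) a i.+2 * h ^+ i.+2.
  rewrite /pseries /series /= /n big_nat_recl// big_nat_recl// expr0 expr1 mulr1.
  by ring.
apply: le_trans (ler_norm_sum _ _ _) _.
apply: (@le_trans _ _ ((`|h| / K) ^+ 2 * \sum_(0 <= i < N) `|a i.+2| * K ^+ i.+2)).
  rewrite mulr_sumr; apply: ler_sum => i _; rewrite normrM mulrCA ler_wpM2l//.
  have -> : (`|h| / K) ^+ 2 * K ^+ i.+2 = `|h| ^+ 2 * K ^+ i.
    by rewrite [K ^+ i.+2]exprS [K ^+ i.+1]exprS; field; rewrite gt_eqF.
  rewrite normrX -[i.+2]/(2 + i)%N exprD ler_wpM2l ?exprn_ge0//.
  by rewrite lerXn2r// ?nnegrE// ltW.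
apply: ler_wpM2l; first by rewrite exprn_ge0// divr_ge0// ltW.
have nd : {homo pseries (fun i => `|a i|) K : x y / (x <= y)%N >-> x <= y}.
  apply/nondecreasing_seqP => m; rewrite /pseries /series /= big_nat_recr//=.
  by rewrite lerDl mulr_ge0// exprn_ge0// ltW.
apply: le_trans _ (nondecreasing_cvgn_le nd cK n).
rewrite /pseries /series /= /n big_nat_recl// big_nat_recl// addrA lerDr.
by rewrite addr_ge0// mulr_ge0// exprn_ge0// ltW.
Qed.

Lemma analytic_derivable (g : R -> R) (d0 : R) : analytic_at g d0 -> derivable g d0 1.
Proof.
move=> [a /nbhs_ballP[r /= r0 Hr]].
have {}Hr h : `|h| < r -> pseries a h @ \oo --> g (d0 + h).
  by move=> hr; apply: Hr; rewrite -ball_normE /= sub0r normrN.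
(* The series converges at [r / 2], hence absolutely at the strictly smaller [r / 4]. *)
pose K := r / 4; have K0 : 0 < K by rewrite divr_gt0.
have cK : cvgn (pseries (fun i => `|a i|) K).
  apply: (@is_cvg_pseries_inside_norm _ a (r / 2)).
    apply/cvg_ex; exists (g (d0 + r / 2)); apply: Hr.
    by rewrite gtr0_norm ?divr_gt0//; move: r0; lra.
  by rewrite !gtr0_norm ?divr_gt0// /K; move: r0; lra.
set S := limn _ in cK.
have Kr : K < r by rewrite /K; move: r0; lra.
have bnd h : `|h| <= K -> `|g (d0 + h) - a 0%N - a 1%N * h| <= (`|h| / K) ^+ 2 * S.
  by move=> hK; apply: power_series_tail => //; apply/Hr/(le_lt_trans hK).
have g0 : g d0 = a 0%N.
  have := bnd 0; rewrite normr0 addr0 mulr0 mul0r expr0n/= mul0r subr0.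
  by move=> /(_ (ltW K0)); rewrite normr_le0 subr_eq0 => /eqP.
suff : is_derive d0 1 g (a 1%N) by case.
apply/is_derive_epsP => e e0.
pose q := Num.min K (e * K ^+ 2 / (`|S| + 1)).
have S0 : 0 < `|S| + 1 by rewrite ltr_wpDl.
have q0 : 0 < q by rewrite lt_min K0/= divr_gt0// mulr_gt0// exprn_gt0.
apply/nbhs_ballP; exists q => //= s; rewrite -ball_normE /= distrC => sq.
have := bnd (s - d0); rewrite addrCA subrr addr0 -g0 => H.
rewrite /GRing.scale /= [_ * a _]mulrC; apply: le_trans (H _) _.
  by apply/ltW/(lt_le_trans sq); rewrite ge_min lexx.
have : `|s - d0| * (`|S| + 1) <= e * K ^+ 2.
  by rewrite -ler_pdivlMr//; apply/ltW/(lt_le_trans sq); rewrite ge_min lexx orbT.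
move: `|s - d0| (normr_ge0 (s - d0)) => u u0 H1.
rewrite exprMn exprVn mulrAC ler_pdivrMr ?exprn_gt0//.
have H2 : u * (u * (`|S| + 1)) <= u * (e * K ^+ 2) by rewrite ler_wpM2l.
have H3 : u * u * S <= u * u * `|S| by rewrite ler_wpM2l ?mulr_ge0// ler_norm.
have H4 : 0 <= u * u by rewrite mulr_ge0.
by rewrite expr2; move: H2 H3 H4; rewrite mulrDr mulr1 mulrDr; clear; lra.
Qed.

Lemma group_flow (M : set (R * R)) (W : set (R * R * R)) (f1 f2 : R * R -> R -> R)
    (omega Ups : R * R -> R) p d :
  one_parameter_group M W f1 f2 ->
  (forall p, M p -> omega p = derive1 (f1 p) 0) ->
  (forall p, M p -> Ups p = derive1 (f2 p) 0) ->
  W (p, d) ->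
  is_derive d 1 (fun u => (f1 p u, f2 p u))
    (omega (f1 p d, f2 p d), Ups (f1 p d, f2 p d)).
Proof.
move=> G Ho HU Wpd; set q := (f1 p d, f2 p d).
have Mq : M q by exact: (group_maps G Wpd).
have [Wq0 q0] := group_id G Mq.
have [a1 a2] := group_analytic G Wq0.
have d1 : is_derive (0 : R) 1 (f1 q) (omega q).
  by rewrite Ho// derive1E; apply/derivableP/analytic_derivable.
have d2 : is_derive (0 : R) 1 (f2 q) (Ups q).
  by rewrite HU// derive1E; apply/derivableP/analytic_derivable.
have d12 := is_derive_pair d1 d2.
have oW := group_open_domain G.
(* The infinitesimals give the derivative at parameter 0 only; the composition law at [q] carries it
   to [d]. That law requires both parameters to be admissible, which openness of [W] ensures for
   small [u]. *)
have Wd : \forall u \near (0 : R), W (p, d + u) /\ W (q, u).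
  have c1 : (p, d + u) @[u --> (0 : R)] --> (p, d).
    apply: (@cvg_pair _ _ _ _ (nbhs p) (nbhs d)); first exact: cvg_cst.
    have c0 : d + u @[u --> (0 : R)] --> d + 0.
      by apply: cvgD; [exact: cvg_cst|exact: cvg_id].
    by rewrite addr0 in c0.
  have c2 : (q, u) @[u --> (0 : R)] --> (q, 0 : R).
    apply: (@cvg_pair _ _ _ _ (nbhs q) (nbhs (0 : R))); first exact: cvg_cst.
    exact: cvg_id.
  apply: filterI; first by apply: c1; exact: open_nbhs_nbhs.
  by apply: c2; exact: open_nbhs_nbhs.
apply/is_derive_epsP => e e0; rewrite (near_shift 0)/= subr0.
move/is_derive_epsP : d12 => /(_ e e0) H.
near=> u.
have [Wpu Wqu] : W (p, d + u) /\ W (q, u) by near: u.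
have Eu := group_comp G Wpd Wqu Wpu; rewrite -/q in Eu.
have Hu : `|(f1 q u, f2 q u) - (f1 q 0, f2 q 0) - (u - 0) *: (omega q, Ups q)|
    <= e * `|u - 0| by near: u.
by move: Hu; rewrite q0 Eu subr0 /= addrK [u + d]addrC.
Unshelve. all: by end_near. Qed.

End GroupFlow.

(** * Dependence of the transformed curve and its derivatives on the parameter *)

Section Jets.
Context {R : realType}.

(* First and second derivative of g along a curve through p with velocity v and
   acceleration w. *)
Definition total1 (g : R * R -> R) (p v : R * R) : R := pt g p * v.1 + px g p * v.2.

Definition total2 (g : R * R -> R) (p v w : R * R) : R :=
  total1 (pt g) p v * v.1 + total1 (px g) p v * v.2 + total1 g p w.

Lemma is_derive_translate (E : normedModType R) (f : R -> E) (a d : R) l :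
  is_derive (d + a) 1 f l <-> is_derive d 1 (fun u => f (u + a)) l.
Proof.
have sh u : u + a - (d + a) = u - d by rewrite opprD addrACA subrr addr0.
split=> /is_derive_epsP H; apply/is_derive_epsP => e e0.
  have := H e e0; rewrite (near_shift d)/= addrAC subrr add0r; apply: filterS => u.
  by rewrite /= sh.
rewrite (near_shift d)/= addrAC subrr add0r; have := H e e0; apply: filterS => u.
by rewrite /= sh.
Qed.

Lemma is_derive_unique (E : normedModType R) (f : R -> E) (a : R) l l' :
  is_derive a 1 f l -> is_derive a 1 f l' -> l = l'.
Proof. by move=> fl fl'; rewrite -(@derive_val _ _ _ _ _ _ _ fl) (@derive_val _ _ _ _ _ _ _ fl'). Qed.

Lemma is_derive_id1 (a : R) : is_derive a 1 (fun u : R => u) (1 : R).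
Proof.
apply/is_derive_epsP => e e0; near=> s.
by rewrite /GRing.scale /= mulr1 subrr normr0 mulr_ge0// ltW.
Unshelve. all: by end_near. Qed.

(** As a function of point and velocity, [total1 g] is the fibre component of the tangent map of
    [g]. Its strict differentiability is what the second-order comparison of orbits requires. *)
Lemma strict_diff_total1 (M : set (R * R)) (g : R * R -> R) (z : (R * R) * (R * R)) :
  open M -> smooth_open M g -> M z.1 ->
  strict_diff (fun z : (R * R) * (R * R) => total1 g z.1 z.2) z
    (fun h => (total1 (pt g) z.1 h.1 * z.2.1 + pt g z.1 * h.2.1)
            + (total1 (px g) z.1 h.1 * z.2.2 + px g z.1 * h.2.2)).
Proof.
move=> oM sg Mz.
have st := smooth_strict_diff oM (smooth_pt sg) Mz.
have sx := smooth_strict_diff oM (smooth_px sg) Mz.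
have s1 : strict_diff (fun z : (R * R) * (R * R) => z.2.1) z (fun h => h.2.1).
  apply: strict_diff_of_linear; first by move=> k u v.
  exists 1 => // h; rewrite mul1r; apply: (@le_trans _ _ `|h.2|).
    by rewrite prod_normE /= le_max lexx.
  by rewrite [leRHS]prod_normE /= le_max lexx orbT.
have s2 : strict_diff (fun z : (R * R) * (R * R) => z.2.2) z (fun h => h.2.2).
  apply: strict_diff_of_linear; first by move=> k u v.
  exists 1 => // h; rewrite mul1r; apply: (@le_trans _ _ `|h.2|).
    by rewrite prod_normE /= le_max lexx orbT.
  by rewrite [leRHS]prod_normE /= le_max lexx orbT.
apply: strict_diffD; apply: strict_diffM.
- exact: (strict_diff_fst (p := z) st).
- exact: s1.
- exact: (strict_diff_fst (p := z) sx).
- exact: s2.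
Qed.

Lemma is_derive_curve (g : R * R -> R) (x : R -> R) (s x1 : R) :
  differentiable g (s, x s) -> is_derive s 1 x x1 ->
  is_derive s 1 (fun u => g (u, x u)) (total1 g (s, x s) (1, x1)).
Proof.
move=> dg dx; rewrite /total1 -derive_plane//.
apply: (@is_derive1_comp _ _ _ g (fun u : R => (u, x u))) => //.
by apply: is_derive_pair => //; exact: is_derive_id1.
Qed.

Lemma is_derive_mul (f g : R -> R) (s a b : R) :
  is_derive s 1 f a -> is_derive s 1 g b ->
  is_derive s 1 (fun u => f u * g u) (a * g s + f s * b).
Proof.
move=> fa gb; have -> : a * g s + f s * b = f s *: b + g s *: a.
  by rewrite /GRing.scale /=; ring.
exact: is_deriveM.
Qed.

Lemma is_derive_add (f g : R -> R) (s a b : R) :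
  is_derive s 1 f a -> is_derive s 1 g b ->
  is_derive s 1 (fun u => f u + g u) (a + b).
Proof. by move=> fa gb; exact: is_deriveD. Qed.

Lemma is_derive_total1 (U : set (R * R)) (g : R * R -> R) (x x1 : R -> R) (s x2 : R) :
  smooth_open U g -> U (s, x s) -> is_derive s 1 x (x1 s) -> is_derive s 1 x1 x2 ->
  is_derive s 1 (fun u => total1 g (u, x u) (1, x1 u))
    (total2 g (s, x s) (1, x1 s) (0, x2)).
Proof.
move=> sg Us dx dx1.
have dt := is_derive_curve (smooth_open_differentiable (smooth_pt sg) Us) dx.
have dxx := is_derive_curve (smooth_open_differentiable (smooth_px sg) Us) dx.
have := is_derive_add (is_derive_mul dt (is_derive_cst (1 : R) s 1))
                      (is_derive_mul dxx dx1).
congr (is_derive _ _ _ _); rewrite /total2 [total1 g _ _]/total1 /=.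
by rewrite !mulr0 !addr0 add0r addrA.
Qed.

Lemma prod_box (P : R * R -> Prop) (t0 : R) :
  (\forall z \near (t0, 0 : R), P z) ->
  exists2 eta, 0 < eta & forall s d : R, `|s - t0| < eta -> `|d| < eta -> P (s, d).
Proof.
move=> /nbhs_ballP[r /= r0 Hr]; exists r => // s d sr dr.
by apply: Hr; split; rewrite -ball_normE /= ?sub0r ?normrN// distrC.
Qed.

(** [c1] and [c2] are the first and second derivatives of the transformed curve with respect to the
    original time. They are left existential: their formulas involve derivatives of [f1] and [f2],
    while later only the relations listed here matter. *)
Lemma group_jets (M : set (R * R)) (W : set (R * R * R)) (f1 f2 : R * R -> R -> R)
    (omega Ups : R * R -> R) (x x1 : R -> R) (t0 x2 : R) :
  one_parameter_group M W f1 f2 ->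
  (forall p, M p -> omega p = derive1 (f1 p) 0) ->
  (forall p, M p -> Ups p = derive1 (f2 p) 0) ->
  smooth_open M omega -> smooth_open M Ups ->
  M (t0, x t0) ->
  (\forall s \near t0, is_derive (s : R) 1 x (x1 s)) -> is_derive t0 1 x1 x2 ->
  let p := (t0, x t0) in let v := (1, x1 t0) in let w := (0, x2) in
  let c := fun s d : R => (f1 (s, x s) d, f2 (s, x s) d) in
  exists (c1 : R -> R -> R * R) (c2 : R -> R * R), exists2 eta, 0 < eta &
    [/\ forall s d : R, `|s - t0| < eta -> `|d| < eta -> is_derive s 1 (c ^~ d) (c1 s d),
        forall d : R, `|d| < eta -> is_derive t0 1 (c1 ^~ d) (c2 d),
        c t0 0 = p /\ is_derive (0 : R) 1 (c t0) (omega p, Ups p),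
        c1 t0 0 = v /\ is_derive (0 : R) 1 (c1 t0) (total1 omega p v, total1 Ups p v) &
        c2 0 = w /\ is_derive (0 : R) 1 c2 (total2 omega p v w, total2 Ups p v w)].
Proof.
move=> G Ho HU so sU Mp dx dx1 p v w c.
pose c1 := fun s d : R => (total1 (f1 ^~ d) (s, x s) (1, x1 s),
                            total1 (f2 ^~ d) (s, x s) (1, x1 s)).
pose c2 := fun d : R => (total2 (f1 ^~ d) p v w, total2 (f2 ^~ d) p v w).
have oM := group_open_space G; have oW := group_open_domain G.
have dx0 : is_derive t0 1 x (x1 t0) by exact: nbhs_singleton dx.
have [eta eta0 box] : exists2 eta, 0 < eta & forall s d : R,
    `|s - t0| < eta -> `|d| < eta -> W ((s, x s), d) /\ is_derive s 1 x (x1 s).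
  apply: (@prod_box (fun z => W ((z.1, x z.1), z.2) /\ is_derive z.1 1 x (x1 z.1))).
  apply: filterI; last exact: (cvg_fst dx).
  have cx := is_derive_continuous dx0.
  have cc : ((z.1, x z.1), z.2) @[z --> (t0, 0 : R)] --> ((t0, x t0), (0 : R)).
    apply: (@cvg_pair _ _ _ _ (nbhs (t0, x t0)) (nbhs (0 : R))); last exact: cvg_snd.
    apply: (@cvg_pair _ _ _ _ (nbhs t0) (nbhs (x t0))); first exact: cvg_fst.
    exact: (cvg_comp _ _ (@cvg_fst _ _ (nbhs t0) (nbhs (0 : R)) _) cx).
  by apply: cc; apply: open_nbhs_nbhs; split => //; have [] := group_id G Mp.
pose V q := (omega q, Ups q).
pose DV (q h : R * R) := (total1 omega q h, total1 Ups q h).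
have sV q : M q -> strict_diff V q (DV q).
  by move=> Mq; apply: strict_diff_pair;
    [exact: (smooth_strict_diff oM so)|exact: (smooth_strict_diff oM sU)].
have Mc (s d : R) : `|s - t0| < eta -> `|d| < eta -> M (c s d).
  by move=> sr dr; have [Ws _] := box s d sr dr; exact: (group_maps G Ws).
have flow (s d : R) : `|s - t0| < eta -> `|d| < eta -> is_derive d 1 (c s) (V (c s d)).
  move=> sr dr; have [Ws _] := box s d sr dr.
  exact: (group_flow G Ho HU Ws).
have cder (s d : R) : `|s - t0| < eta -> `|d| < eta -> is_derive s 1 (c ^~ d) (c1 s d).
  move=> sr dr; have [Ws dxs] := box s d sr dr; have [s1 s2] := group_smooth G d.
  by apply: is_derive_pair; apply: is_derive_curve => //;
    [exact: (smooth_open_differentiable s1)|exact: (smooth_open_differentiable s2)].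
have t0t0 : `|t0 - t0| < eta by rewrite subrr normr0.
have c1der (d : R) : `|d| < eta -> is_derive t0 1 (c1 ^~ d) (c2 d).
  move=> dr; have [Ws _] := box t0 d t0t0 dr; have [s1 s2] := group_smooth G d.
  by apply: is_derive_pair;
    [exact: (is_derive_total1 s1)|exact: (is_derive_total1 s2)].
(* [flow_deriv] differentiates at parameter 0 only. Recentring at [(s, d)], in a box of size [e]
   inside the original one, gives the linearized equation at every small [d]. *)
have flow1 (s d : R) : `|s - t0| < eta -> `|d| < eta ->
    is_derive d 1 (c1 s) (DV (c s d) (c1 s d)).
  move=> sr dr.
  suff : is_derive (0 + d) 1 (c1 s) (DV (c s d) (c1 s d)) by rewrite add0r.
  apply/is_derive_translate.
  pose e := Num.min (eta - `|s - t0|) (eta - `|d|).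
  have e0 : 0 < e by rewrite lt_min !subr_gt0 sr.
  have [es ed] : e <= eta - `|s - t0| /\ e <= eta - `|d|.
    by rewrite !ge_min !lexx orbT.
  have inbox_d (u : R) : `|u| < e -> `|u + d| < eta.
    by move=> ue; apply: le_lt_trans (ler_normD _ _) _; move: ue ed; lra.
  have inbox_s (u : R) : `|u - s| < e -> `|u - t0| < eta.
    move=> ue; rewrite -(subrKA s); apply: le_lt_trans (ler_normD _ _) _.
    by move: ue es; lra.
  have := @flow_deriv R _ V (fun s u => c s (u + d)) s e (DV (c s d))
    (fun u => c1 s (u + d)) e0.
  rewrite add0r; apply.
  - by apply: sV; exact: Mc.
  - move=> u y us ye; have D := flow u (y + d) (inbox_s u us) (inbox_d y ye).
    exact: (proj1 (is_derive_translate (c u) d y _) D).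
  - by move=> y ye; exact: (cder s (y + d) sr (inbox_d y ye)).
(* The linearized field on pairs of a point and a velocity; the pairs of [c] and [c1] are its
   orbits. *)
pose V1 (z : (R * R) * (R * R)) := (V z.1, DV z.1 z.2).
have z0 : `|0 : R| < eta by rewrite normr0.
have c0 (s : R) : `|s - t0| < eta -> c s 0 = (s, x s).
  move=> sr; have [Ws _] := box s 0 sr z0.
  by have [] := group_id G (group_domain_sub G Ws).
clearbody c c1 c2.
(* At parameter 0 the curve is the graph of [x], so its derivatives follow from uniqueness of the
   derivative, with no computation on [f1] and [f2]. *)
have c10 (s : R) : `|s - t0| < eta -> c1 s 0 = (1, x1 s).
  move=> sr; apply: is_derive_unique (cder s 0 sr z0) _.
  have [_ dxs] := box s 0 sr z0.
  apply: (@near_eq_is_derive _ _ _ (fun u : R => (u, x u))).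
    apply/nbhs_ballP; exists (eta - `|s - t0|) => /=; first by rewrite subr_gt0.
    move=> u; rewrite -ball_normE /= distrC => us; rewrite c0//.
    rewrite -(subrKA s); apply: le_lt_trans (ler_normD _ _) _.
    by move: us; lra.
  by apply: is_derive_pair => //; exact: is_derive_id1.
have c20 : c2 0 = w.
  apply: is_derive_unique (c1der 0 z0) _.
  apply: (@near_eq_is_derive _ _ _ (fun u : R => (1 : R, x1 u))).
    apply/nbhs_ballP; exists eta => //= u.
    by rewrite -ball_normE /= distrC => us; rewrite c10.
  by apply: is_derive_pair => //; exact: is_derive_cst.
have c0p : c t0 0 = p by exact: c0.
have c10v : c1 t0 0 = v by exact: c10.
exists c1, c2, eta => //; split => //.
- by split => //; have := flow t0 0 t0t0 z0; rewrite c0p.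
- by split => //; have := flow1 t0 0 t0t0 z0; rewrite c0p c10v.
split => //.
(* The derivative of [V1] at [(p, v)]; at the increment [(v, w)] its second component is the pair of
   values of [total2]. *)
pose L h := (DV p h.1,
  ((total1 (pt omega) p h.1 * v.1 + pt omega p * h.2.1)
     + (total1 (px omega) p h.1 * v.2 + px omega p * h.2.2),
   (total1 (pt Ups) p h.1 * v.1 + pt Ups p * h.2.1)
     + (total1 (px Ups) p h.1 * v.2 + px Ups p * h.2.2))).
have sV1 : strict_diff V1 (c t0 0, c1 t0 0) L.
  rewrite c0p c10v; apply: strict_diff_pair.
    by apply: (@strict_diff_fst _ _ _ _ V (p, v)); exact: sV.
  apply: strict_diff_pair; first exact: (@strict_diff_total1 M omega (p, v)).
  exact: (@strict_diff_total1 M Ups (p, v)).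
have H1 (s d : R) : `|s - t0| < eta -> `|d| < eta ->
    is_derive d 1 (fun d => (c s d, c1 s d)) (V1 (c s d, c1 s d)).
  by move=> sr dr; apply: is_derive_pair; [exact: flow|exact: flow1].
have H2 (d : R) : `|d| < eta ->
    is_derive t0 1 (fun s => (c s d, c1 s d)) (c1 t0 d, c2 d).
  by move=> dr; apply: is_derive_pair; [exact: cder|exact: c1der].
have := @flow_deriv R _ V1 (fun s d => (c s d, c1 s d)) t0 eta L
  (fun d => (c1 t0 d, c2 d)) eta0 sV1 H1 H2.
move=> /is_derive_snd /=; rewrite c10v c20.
congr (is_derive _ _ _ _); congr pair.
  by rewrite /total2 [total1 omega p w]/total1 addrACA.
by rewrite /total2 [total1 Ups p w]/total1 addrACA.
Qed.

End Jets.

(** * Prolongation of the infinitesimals to the first and second derivatives *)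

Section Curves.
Context {R : realType}.

Lemma within_mem (T : Type) (F : set_system T) (A : set T) :
  Filter F -> F A -> within A F = F.
Proof.
move=> FF FA; apply/seteqP; split=> P /= H; last by apply: filterS H.
by apply: filterS2 FA H => u Au; exact.
Qed.

Lemma derive_in_filter (J : set R) (s : R) : nbhs s J ->
  within [set h | J (h *: 1 + s)] 0^' = (0 : R)^'.
Proof.
move=> Js; apply: within_mem; apply: nbhs_dnbhs.
have : (h *: 1 + s : R) @[h --> (0 : R)] --> 0 *: 1 + s.
  by apply: cvgD; [apply: cvgZr_tmp; exact: cvg_id|exact: cvg_cst].
by rewrite scale0r add0r; apply.
Qed.

Lemma der_interior (J : set R) (f : R -> R) (s l : R) :
  nbhs s J -> is_derive s 1 f l -> der J f s = l.
Proof.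
move=> Js [_ <-]; rewrite /der /derive_in derive_in_filter//.
Qed.

Lemma derivable_in_interior (J : set R) (f : R -> R) (s : R) :
  nbhs s J -> derivable_in J f s 1 -> is_derive s 1 f (der J f s).
Proof.
move=> Js; rewrite /derivable_in derive_in_filter// => df.
have df' : derivable f s 1 by exact: df.
by rewrite (der_interior Js (derivableP df')); exact: derivableP.
Qed.

Lemma is_derive_sub (f g : R -> R) (s a b : R) :
  is_derive s 1 f a -> is_derive s 1 g b ->
  is_derive s 1 (fun u => f u - g u) (a - b).
Proof. by move=> fa gb; exact: is_deriveB. Qed.

Lemma is_derive_div (f g : R -> R) (s a b : R) :
  g s != 0 -> is_derive s 1 f a -> is_derive s 1 g b ->
  is_derive s 1 (fun u => f u / g u) ((a * g s - f s * b) / (g s * g s)).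
Proof.
move=> gs fa gb; have gi := is_deriveV gs gb.
have := is_derive_mul fa gi; congr (is_derive _ _ _ _).
by rewrite /GRing.scale /=; field.
Qed.

(** The quotient rule turns the [d]-derivatives of [c1] and [c2] into those of dX/dT and its
    iterate. At [d = 0] the curve has velocity [(1, y1)] and acceleration [(0, y2)], so all
    denominators are 1 and the quotients collapse to the prolongation coefficients. *)
Lemma curve_jets (M : set (R * R)) (W : set (R * R * R)) (f1 f2 : R * R -> R -> R)
    (omega Ups : R * R -> R) (J : set R) (x : R -> R) (t0 : R) :
  one_parameter_group M W f1 f2 ->
  (forall p, M p -> omega p = derive1 (f1 p) 0) ->
  (forall p, M p -> Ups p = derive1 (f2 p) 0) ->
  smooth_open M omega -> smooth_open M Ups ->
  nbhs t0 J -> M (t0, x t0) ->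
  (forall s, J s -> derivable_in J x s 1 /\ derivable_in J (der J x) s 1) ->
  let p := (t0, x t0) in
  let y1 := der J x t0 in let y2 := der J (der J x) t0 in
  let T := fun d s : R => f1 (s, x s) d in
  let X := fun d s : R => f2 (s, x s) d in
  let X1 := fun d : R => curve_der J (T d) (X d) in
  let X2 := fun d : R => curve_der J (T d) (X1 d) in
  [/\ T 0 t0 = t0 /\ is_derive (0 : R) 1 (T ^~ t0) (omega p),
      X 0 t0 = x t0 /\ is_derive (0 : R) 1 (X ^~ t0) (Ups p),
      X1 0 t0 = y1 /\ is_derive (0 : R) 1 (X1 ^~ t0) (prolong1 omega Ups p y1) &
      X2 0 t0 = y2 /\ is_derive (0 : R) 1 (X2 ^~ t0) (prolong2 omega Ups p y1 y2)].
Proof.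
move=> G Ho HU so sU Jt Mp dx p y1 y2 T X X1 X2.
have oM := group_open_space G.
have /nbhs_ballP[r /= r0 Hr] := Jt.
have {}Hr (s : R) : `|s - t0| < r -> nbhs s J.
  move=> sr; apply/nbhs_ballP; exists (r - `|s - t0|) => /=; first by rewrite subr_gt0.
  move=> u; rewrite -ball_normE /= distrC => us; apply: Hr; rewrite -ball_normE /= distrC.
  by rewrite -(subrKA s); apply: le_lt_trans (ler_normD _ _) _; move: us; lra.
have dx1 : \forall s \near t0, is_derive (s : R) 1 x (der J x s).
  apply/nbhs_ballP; exists r => //= s; rewrite -ball_normE /= distrC => /Hr Js.
  apply: derivable_in_interior => //.
  by have [] := dx s (nbhs_singleton Js).
have dx2 : is_derive t0 1 (der J x) y2.
  by apply: derivable_in_interior => //; have [] := dx t0 (nbhs_singleton Jt).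
have [c1 [c2 [eta' eta'0]]] := group_jets G Ho HU so sU Mp dx1 dx2.
rewrite -/p -/y1; set v := (1, y1); set w := (0, y2).
set c := fun s d : R => (f1 (s, x s) d, f2 (s, x s) d).
move=> [dc dc1 [c0 dc0] [c10 dc10] [c20 dc20]].
pose eta := Num.min eta' r.
have eta0 : 0 < eta by rewrite lt_min eta'0.
have eta_le (u : R) : `|u| < eta -> `|u| < eta' /\ `|u| < r.
  by rewrite lt_min => /andP.
have t00 : `|t0 - t0| < eta by rewrite subrr normr0.
have X1E (s d : R) : `|s - t0| < eta -> `|d| < eta ->
    X1 d s = (c1 s d).2 / (c1 s d).1.
  move=> /eta_le[sr sr'] /eta_le[dr _]; have D := dc s d sr dr.
  rewrite /X1 /curve_der (der_interior (Hr s sr') (is_derive_fst D)).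
  by rewrite (der_interior (Hr s sr') (is_derive_snd D)).
(* Differentiating [X1] in [s] requires its formula on an interval around [t0]; the outer quotient
   is needed at [t0] only. *)
have X2E (d : R) : `|d| < eta -> (c1 t0 d).1 != 0 ->
    X2 d t0 = ((c2 d).2 * (c1 t0 d).1 - (c1 t0 d).2 * (c2 d).1)
              / ((c1 t0 d).1 * (c1 t0 d).1) / (c1 t0 d).1.
  move=> dr c1n; have [dr' _] := eta_le _ dr.
  have [tr _] := eta_le _ t00.
  rewrite /X2 /curve_der (der_interior Jt (is_derive_fst (dc t0 d tr dr'))).
  congr (_ / _); apply: der_interior => //.
  have D := dc1 d dr'.
  have := is_derive_div c1n (is_derive_snd D) (is_derive_fst D).
  apply: near_eq_is_derive.
  apply/nbhs_ballP; exists eta => //= s; rewrite -ball_normE /= distrC => sr.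
  by rewrite X1E.
have n0 : `|0 : R| < eta by rewrite normr0.
have A1 := is_derive_fst dc10; have B1 := is_derive_snd dc10.
have A2 := is_derive_fst dc20; have B2 := is_derive_snd dc20.
have v1 : (c1 t0 0).1 = 1 by rewrite c10.
have v2 : (c1 t0 0).2 = y1 by rewrite c10.
have w1 : (c2 0).1 = 0 by rewrite c20.
have w2 : (c2 0).2 = y2 by rewrite c20.
rewrite /= in A1 B1 A2 B2.
have n1 : (c1 t0 0).1 != 0 by rewrite v1 oner_eq0.
have n2 : (c1 t0 0).1 * (c1 t0 0).1 != 0 by rewrite v1 mulr1 oner_eq0.
have c1near : \forall d \near (0 : R), (c1 t0 d).1 != 0.
  have /cvgrPdist_lt /(_ 1 ltr01) := is_derive_continuous A1.
  apply: filterS => d; rewrite v1 => H; apply/eqP => E.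
  by move: H; rewrite E subr0 normr1 ltxx.
have etanear : \forall d \near (0 : R), `|d| < eta.
  by apply/nbhs_ballP; exists eta => //= d; rewrite -ball_normE /= sub0r normrN.
split.
- split; first by case: c0.
  exact: is_derive_fst dc0.
- split; first by case: c0.
  exact: is_derive_snd dc0.
- split; first by rewrite X1E// v1 v2 divr1.
  have := is_derive_div n1 B1 A1; rewrite v1 v2 => D.
  have E : (total1 Ups p v * 1 - y1 * total1 omega p v) / (1 * 1) =
     prolong1 omega Ups p y1.
    rewrite /prolong1 /total1 /v /=.
    move: (pt Ups p) (px Ups p) (pt omega p) (px omega p) => *.
    by rewrite !mulr1 divr1; ring.
  rewrite -E; apply: near_eq_is_derive D.
  by apply: filterS etanear => d dr; rewrite X1E.
- split; first by rewrite X2E// v1 v2 w1 w2 !mulr1 mulr0 subr0 !divr1.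
  have N := is_derive_sub (is_derive_mul B2 A1) (is_derive_mul B1 A2).
  have N2 := is_derive_div (g := fun u => (c1 t0 u).1 * (c1 t0 u).1) n2 N
    (is_derive_mul A1 A1).
  have := is_derive_div n1 N2 A1.
  rewrite /= v1 v2 w1 w2 => D.
  refine (near_eq_is_derive _ (is_derive_eq D _)).
    by apply: filterS2 etanear c1near => d dr cn; rewrite X2E.
  rewrite /prolong2 /total2 /total1 /v /w /=.
  (* [total2] produces both mixed derivatives, [prolong2] has one of them with coefficient 2. *)
  rewrite -(smooth_symmetric oM so Mp) -(smooth_symmetric oM sU Mp).
  move: (pt Ups p) (px Ups p) (pt omega p) (px omega p).
  move: (pt (pt Ups) p) (px (pt Ups) p) (px (px Ups) p).
  move: (pt (pt omega) p) (px (pt omega) p) (px (px omega) p) => *.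
  by rewrite !mulr1 !divr1; ring.
Qed.

End Curves.

(** * Interior points *)

Section Interior.
Context {R : realType}.

(** The last hypothesis makes the restricted filter proper; without increments inside [A] the limit
    would carry no information. With it, the restricted derivative of [f] can be computed from any
    local extension differentiable at [a]. *)
Lemma derive_in_extension (V : normedModType R) (A U : set V) (f g : V -> R) (a e : V) :
  open U -> U a -> A a -> differentiable g a ->
  (forall q, U q -> A q -> g q = f q) ->
  (forall eps : R, 0 < eps -> exists h : R, [/\ h != 0, `|h| < eps & A (h *: e + a)]) ->
  derive_in A f a e = 'D_e g a.
Proof.
move=> oU Ua Aa dg gf dir; rewrite /derive_in.
set FF := within _ _.
have PF : ProperFilter FF.
  split; last exact: within_filter.
  rewrite /FF /within /= => -/nbhs_ballP[r /= r0 Hr].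
  have [h [h0 hr Ah]] := dir r r0.
  by apply: (Hr h) => //; rewrite -ball_normE /= sub0r normrN.
have gD : h^-1 * (g (h *: e + a) - g a) @[h --> FF] --> 'D_e g a.
  have /derivableP/@ex_derive H : derivable g a e by exact: diff_derivable.
  apply: cvg_trans H; apply: cvg_app; exact: cvg_within.
apply: cvg_lim => //; apply: cvg_trans gD; apply: near_eq_cvg.
have nU : nbhs (0 : R) [set h | U (h *: e + a)].
  have : (h *: e + a : V) @[h --> (0 : R)] --> 0 *: e + a.
    by apply: cvgD; [apply: cvgZr_tmp; exact: cvg_id|exact: cvg_cst].
  by rewrite scale0r add0r; apply; exact: open_nbhs_nbhs.
rewrite /FF near_withinE; apply: nbhs_dnbhs; apply: filterS nU => h Uh Ah.
by rewrite (gf _ Uh Ah) (gf _ Ua Aa).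
Qed.

Lemma nbhs_setX (X Y : topologicalType) (a : X) (b : Y) (A : set X) (B : set Y) :
  nbhs a A -> nbhs b B -> nbhs (a, b) (A `*` B).
Proof. by move=> nA nB; exists (A, B). Qed.

Lemma derive_arg_type (G : arg_type R -> R) (a : arg_type R)
    (w1 w2 w3 w4 w5 w6 w7 : R) :
  differentiable G a ->
  'D_((w1, w2, w3, w4, w5, w6, w7) : arg_type R) G a =
    w1 * 'D_(e_t R) G a + w2 * 'D_(e_x R) G a + w3 * 'D_(e_tr R) G a
    + w4 * 'D_(e_xr R) G a + w5 * 'D_(e_x1 R) G a + w6 * 'D_(e_x1r R) G a
    + w7 * 'D_(e_x2r R) G a.
Proof.
move=> dG; rewrite -!deriveZv// -!deriveDv//; congr ('D_ _ G a).
have ext (X Y : Type) (u v : X * Y) : u.1 = v.1 -> u.2 = v.2 -> u = v.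
  by case: u v => ? ? [? ?] /= -> ->.
do 6!(apply: (ext); last by rewrite /= /GRing.scale /=; ring).
by rewrite /= /GRing.scale /=; ring.
Qed.

Lemma nbhs_sol_set (I : set R) (r t : R) : nbhs t I ->
  nbhs t (sol_set I r) /\ nbhs (t - r) (shift_set I r) /\
  nbhs (t - r) (sol_set I r).
Proof.
move=> nI.
have nS : nbhs (t - r) (shift_set I r).
  have : (u + r : R) @[u --> t - r] --> t - r + r.
    by apply: cvgD; [exact: cvg_id|exact: cvg_cst].
  rewrite subrK => H; have HI : \forall u \near t - r, I (u + r) by exact: H.
  apply: filterS HI => u Iu.
  by exists (u + r) => //; rewrite addrK.
split; first by apply: filterS nI => u; left.
by split => //; apply: filterS nS => u; right.
Qed.

(** The left-hand side of the invariance condition as a function of the argument tuple, so that the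
    tuple may vary independently of any solution when continuity is used. *)
Definition generator_terms (omega Ups : R * R -> R) (dF : arg_type R -> R)
    (a : arg_type R) : R :=
  let p := (a.1.1.1.1.1.1, a.1.1.1.1.1.2) in
  let pr := (a.1.1.1.1.2, a.1.1.1.2) in
  omega p * dF (e_t R) + Ups p * dF (e_x R)
  + omega pr * dF (e_tr R) + Ups pr * dF (e_xr R)
  + prolong1 omega Ups p a.1.1.2 * dF (e_x1 R)
  + prolong1 omega Ups pr a.1.2 * dF (e_x1r R)
  + prolong2 omega Ups pr a.1.2 a.2 * dF (e_x2r R).

(** The second derivative at [t] appears as [G a], to which the equation makes it equal. Both sides
    then depend on the tuple [a] alone, and no convergence of the second derivative at [t] itself
    will be needed. *)
Lemma interior_invariance (r : R) (I D : set R) (F : arg_type R -> R)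
    (M : set (R * R)) (W : set (R * R * R)) (f1 f2 : R * R -> R -> R)
    (omega Ups : R * R -> R) (U : set (arg_type R)) (G : arg_type R -> R)
    (x : R -> R) (t : R) :
  open D -> one_parameter_group M W f1 f2 ->
  sol_set I r `*` D `<=` M ->
  (forall p, M p -> omega p = derive1 (f1 p) 0) ->
  (forall p, M p -> Ups p = derive1 (f2 p) 0) ->
  smooth_open M omega -> smooth_open M Ups ->
  invariant_under r I D F f1 f2 -> solution r I D F x ->
  nbhs t I ->
  let J := sol_set I r in
  let a := sol_args r J x t in
  open U -> U a -> differentiable G a ->
  (forall q, U q -> eq_dom r I D q -> G q = F q) ->
  generator_terms omega Ups (fun e => 'D_e G a) a
    = prolong2 omega Ups (t, x t) (der J x t) (G a).
Proof.
move=> oD gr JDM Ho HU so sU inv sol nI J a oU Ua dG GF.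
have It : I t by exact: nbhs_singleton.
have [dx /(_ t It)[Aa Ea]] := sol.
have [nJ [nS nJr]] := nbhs_sol_set r nI.
have [[[[[[_ Dx] _] Dxr] Dx1] Dx1r] Dx2r] := Aa.
rewrite /= in Dx Dxr Dx1 Dx1r Dx2r.
have Mp : M (t, x t) by apply: JDM; split => //; exact: nbhs_singleton.
have Mpr : M (t - r, x (t - r)) by apply: JDM; split => //; exact: nbhs_singleton.
have [[T0 dT] [X0 dX] [Y0 dY] [Z0 dZ]] := curve_jets gr Ho HU so sU nJ Mp dx.
have [[T0r dTr] [X0r dXr] [Y0r dYr] [Z0r dZr]] :=
  curve_jets gr Ho HU so sU nJr Mpr dx.
pose args (d : R) : arg_type R :=
  curve_args r J (fun s => f1 (s, x s) d) (fun s => f2 (s, x s) d) t.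
have args0 : args 0 = a.
  by rewrite /args /curve_args T0 X0 Y0 T0r X0r Y0r Z0r.
have dargs := is_derive_pair (is_derive_pair (is_derive_pair (is_derive_pair
  (is_derive_pair (is_derive_pair dT dX) dTr) dXr) dY) dYr) dZr.
have nD (y : R) : D y -> nbhs y D by move=> Dy; exact: open_nbhs_nbhs.
(* For interior [t] both [I] and its shift are neighbourhoods of the respective components, so
   invariance applies to every small [d]. *)
have ndom : nbhs a (eq_dom r I D).
  by do 6?apply: nbhs_setX => //; exact: nD.
have nU : nbhs a U by exact: open_nbhs_nbhs.
have cargs : {for (0 : R), continuous args} := is_derive_continuous dargs.
have nargs : \forall d \near (0 : R), eq_dom r I D (args d) /\ U (args d).
  by apply: filterI; apply: cargs; rewrite args0.
have dG0 : differentiable G (args 0) by rewrite args0.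
have dGa := @is_derive1_comp R (arg_type R) R G args 0 _ dG0 dargs.
have eqn : \forall d \near (0 : R), G (args d) =
    curve_der J (fun s => f1 (s, x s) d)
      (curve_der J (fun s => f1 (s, x s) d) (fun s => f2 (s, x s) d)) t.
  have invt := inv x sol t It.
  near=> d.
  have [Ad Ud] : eq_dom r I D (args d) /\ U (args d) by near: d.
  rewrite GF//; symmetry; move: Ad; rewrite /args.
  by near: d.
have := is_derive_unique (near_eq_is_derive eqn dGa) dZ.
rewrite args0 derive_arg_type// => E.
rewrite /generator_terms /= E.
by congr (prolong2 _ _ _ _ _); rewrite GF// -Ea.
Unshelve. all: by end_near. Qed.

End Interior.

(** * Boundary points *)

Section Boundary.
Context {R : realType}.

Lemma derivable_in_epsP (J : set R) (f : R -> R) (s : R) : derivable_in J f s 1 ->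
  forall e, 0 < e -> exists2 delta : R, 0 < delta & forall u, J u -> u != s ->
    `|u - s| < delta -> `|der J f s - (f u - f s) / (u - s)| < e.
Proof.
move=> /cvgrPdist_lt df e e0; have := df e e0.
move=> /nbhs_ballP[delta /= delta0 H]; exists delta => // u Ju us ud.
have := H (u - s); rewrite -ball_normE /= sub0r normrN => /(_ ud).
rewrite subr_eq0 => /(_ us); rewrite (_ : (u - s) *: 1 + s = u).
  by move=> /(_ Ju); rewrite mulrC.
by rewrite /GRing.scale /= mulr1 subrK.
Qed.

Lemma derivable_in_continuous (J : set R) (f : R -> R) (s : R) : derivable_in J f s 1 ->
  forall e, 0 < e -> exists2 delta : R, 0 < delta & forall u, J u ->
    `|u - s| < delta -> `|f u - f s| < e.
Proof.
move=> df e e0; have [delta delta0 H] := derivable_in_epsP df ltr01.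
set l := der J f s in H.
have L0 : 0 < `|l| + 1 by rewrite ltr_wpDl.
exists (Num.min delta (e / (`|l| + 1))).
  by rewrite lt_min delta0 divr_gt0.
move=> u Ju; rewrite lt_min => /andP[u1 u2].
have [->|us] := eqVneq u s; first by rewrite subrr normr0.
have us0 : 0 < `|u - s| by rewrite normr_gt0 subr_eq0.
have := H u Ju us u1; set q := (f u - f s) / (u - s) => Hq.
have -> : f u - f s = q * (u - s) by rewrite /q divfK// subr_eq0.
rewrite normrM; have : `|q| <= `|l| + 1.
  rewrite -[q](subKr l); apply: le_trans (ler_normB _ _) _.
  by rewrite lerD2l ltW.
move=> qL; apply: (@le_lt_trans _ _ ((`|l| + 1) * `|u - s|)).
  by rewrite ler_wpM2r.
by rewrite mulrC -ltr_pdivlMr.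
Qed.

(** A nondegenerate interval leaves room on at least one side of [t], which decides the sign of [h].
    This serves both the one-sided derivatives and the approach to an endpoint. *)
Lemma interval_accumulation (I : set R) (t : R) :
  is_interval I -> (exists a b, [/\ I a, I b & a < b]) -> I t ->
  forall e, 0 < e -> exists h : R, [/\ h != 0, `|h| < e & I (t + h)].
Proof.
move=> iI [a [b [Ia Ib ab]]] It e e0.
have [tb|bt] := ltP t b.
  have m0 : 0 < Num.min (e / 2) (b - t) by rewrite lt_min divr_gt0// subr_gt0.
  have [m1 m2] : Num.min (e / 2) (b - t) <= e / 2 /\
    Num.min (e / 2) (b - t) <= b - t by rewrite !ge_min !lexx orbT.
  exists (Num.min (e / 2) (b - t)); split; first by rewrite gt_eqF.
    by rewrite gtr0_norm//; move: e0 m1; lra.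
  by apply: (iI t b) => //; apply/andP; split; move: m0 m2; lra.
have at_ : a < t by exact: lt_le_trans bt.
have m0 : 0 < Num.min (e / 2) (t - a) by rewrite lt_min divr_gt0// subr_gt0.
have [m1 m2] : Num.min (e / 2) (t - a) <= e / 2 /\
  Num.min (e / 2) (t - a) <= t - a by rewrite !ge_min !lexx orbT.
exists (- Num.min (e / 2) (t - a)); split; first by rewrite oppr_eq0 gt_eqF.
  by rewrite normrN gtr0_norm//; move: e0 m1; lra.
by apply: (iI a t) => //; apply/andP; split; move: m0 m2; lra.
Qed.

Lemma interval_interior (I : set R) (a b c : R) :
  is_interval I -> I a -> I b -> a < c < b -> nbhs c I.
Proof.
move=> iI Ia Ib /andP[ac cb].
have : c \in `]a, b[%R by rewrite in_itv /= ac.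
move=> /near_in_itvoo; apply: filterS => u; rewrite in_itv /= => /andP[au ub].
by apply: (iI a b) => //; rewrite !ltW.
Qed.

(* A derivative has the Darboux property, so although y' need not be continuous
   at an endpoint, its value there is a limit of its values at interior points. *)
Lemma der_interior_approx (I : set R) (r : R) (y : R -> R) (t : R) :
  is_interval I -> (exists a b, [/\ I a, I b & a < b]) -> I t ->
  let J := sol_set I r in
  (forall s, J s -> derivable_in J y s 1) ->
  forall e, 0 < e -> exists tau : R, [/\ nbhs tau I, `|tau - t| < e &
    `|der J y (t - r) - der J y (tau - r)| < e].
Proof.
move=> iI nI It J dy e e0.
have JI s : I s -> J (s - r) by move=> Is; right; exists s.
have [delta delta0 H] := derivable_in_epsP (dy _ (JI _ It)) e0.
have m0 : 0 < Num.min e delta by rewrite lt_min e0.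
have [h [h0 hm Ih]] := interval_accumulation iI nI It m0.
move: hm; rewrite lt_min => /andP[he hd].
(* The approximating point is a mean value point: the difference quotient between [t - r] and
   [t + h - r] is close to the derivative at [t - r] and equal to the derivative at the shift of an
   interior point. *)
have mvt (a b : R) : I a -> I b -> a < b -> exists c, [/\ nbhs c I, a < c < b &
    y (b - r) - y (a - r) = der J y (c - r) * (b - a)].
  move=> Ia Ib ab.
  have [|||c] := @MVT _ y (der J y) (a - r) (b - r).
  - by rewrite ltrD2r.
  - move=> w; rewrite in_itv /= => /andP[aw wb].
    have wI : nbhs (w + r) I.
      by apply: (interval_interior iI Ia Ib); move: aw wb; rewrite ltrBlDr ltrBrDr => -> ->.
    have [_ [_ nJ]] := nbhs_sol_set r wI; rewrite addrK in nJ.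
    by apply: derivable_in_interior => //; apply: dy; exact: nbhs_singleton.
  - apply/subspace_continuousP => w; rewrite /= in_itv /= => /andP[aw wb].
    have IJ u : a - r <= u <= b - r -> J u.
      move=> /andP[au ub]; rewrite -[u](addrK r); apply: JI; apply: (iI a b) => //.
      by move: au ub; rewrite lerBlDr lerBrDr => -> ->.
    have Jw : J w by apply: IJ; rewrite aw.
    apply/cvgrPdist_lt => q q0.
    have [k k0 Hk] := derivable_in_continuous (dy _ Jw) q0.
    rewrite near_withinE; apply/nbhs_ballP; exists k => //= u.
    rewrite -ball_normE /= distrC => uk; rewrite in_itv /= => /IJ Ju.
    by rewrite distrC; exact: Hk.
  rewrite in_itv /= => /andP[ac cb] E; exists (c + r).
  have cI : a < c + r < b by move: ac cb; rewrite ltrBlDr ltrBrDr => -> ->.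
  split => //; first exact: (interval_interior iI Ia Ib).
  by rewrite addrK E; congr (_ * _); ring.
have Hq : `|der J y (t - r) - (y (t + h - r) - y (t - r)) / h| < e.
  have E : t + h - r - (t - r) = h by ring.
  have := H (t + h - r) (JI _ Ih); rewrite E; apply => //.
  by rewrite -subr_eq0 E.
have [hp|hn] := ltP 0 h.
  have [|c [nc /andP[tc ct] E]] := mvt t (t + h) It Ih; first by rewrite ltrDl.
  exists c; split => //.
    by rewrite gtr0_norm ?subr_gt0//; move: ct he; rewrite gtr0_norm//; lra.
  by move: Hq; rewrite E [t + h]addrC addrK mulfK.
have {}hn : h < 0 by rewrite lt_neqAle h0.
have [|c [nc /andP[tc ct] E]] := mvt (t + h) t Ih It; first by rewrite gtrDl.
exists c; split => //.
  by rewrite ltr0_norm ?subr_lt0//; move: tc he; rewrite ltr0_norm//; lra.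
have E' : y (t + h - r) - y (t - r) = der J y (c - r) * h.
  by rewrite -opprB E; ring.
by move: Hq; rewrite E' mulfK.
Qed.

(** * Continuity of the prolonged coefficients *)

Section Continuity.
Context {T : topologicalType} (a : T).
Implicit Types f g : T -> R.

Lemma for_continuousD f g : {for a, continuous f} -> {for a, continuous g} ->
  {for a, continuous (fun q => f q + g q)}.
Proof. by move=> cf cg; exact: cvgD cf cg. Qed.

Lemma for_continuousB f g : {for a, continuous f} -> {for a, continuous g} ->
  {for a, continuous (fun q => f q - g q)}.
Proof. by move=> cf cg; exact: cvgB cf cg. Qed.

Lemma for_continuousM f g : {for a, continuous f} -> {for a, continuous g} ->
  {for a, continuous (fun q => f q * g q)}.
Proof. by move=> cf cg; exact: cvgM cf cg. Qed.

Lemma for_continuous_cst (k : R) : {for a, continuous (fun _ : T => k)}.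
Proof. exact: cvg_cst. Qed.

Lemma for_continuousX f n : {for a, continuous f} ->
  {for a, continuous (fun q => f q ^+ n)}.
Proof.
move=> cf; elim: n => [|n IHn]; first exact: for_continuous_cst.
have -> : (fun q => f q ^+ n.+1) = (fun q => f q * f q ^+ n).
  by apply/funext => q; rewrite exprS.
exact: for_continuousM.
Qed.

Lemma for_continuous_plane (h : R * R -> R) f g :
  {for a, continuous f} -> {for a, continuous g} ->
  {for (f a, g a), continuous h} -> {for a, continuous (fun q => h (f q, g q))}.
Proof.
move=> cf cg ch; apply: (@cvg_comp _ _ _ (fun q => (f q, g q)) h _ _ _ _ ch).
by apply: (@cvg_pair _ _ _ _ (nbhs (f a)) (nbhs (g a))); [exact: cf|exact: cg].
Qed.

Lemma for_continuous_fst (X Y : topologicalType) (f : T -> X * Y) :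
  {for a, continuous f} -> {for a, continuous (fun q => (f q).1)}.
Proof.
by move=> cf; apply: (@cvg_comp _ _ _ f fst _ _ _ cf); exact: cvg_fst.
Qed.

Lemma for_continuous_snd (X Y : topologicalType) (f : T -> X * Y) :
  {for a, continuous f} -> {for a, continuous (fun q => (f q).2)}.
Proof.
by move=> cf; apply: (@cvg_comp _ _ _ f snd _ _ _ cf); exact: cvg_snd.
Qed.

Context (M : set (R * R)) (omega Ups : R * R -> R) (f g h k : T -> R).
Hypotheses (so : smooth_open M omega) (sU : smooth_open M Ups)
  (cf : {for a, continuous f}) (cg : {for a, continuous g})
  (ch : {for a, continuous h}) (ck : {for a, continuous k}) (Ma : M (f a, g a)).

Lemma for_continuous_smooth (u : R * R -> R) : smooth_open M u ->
  {for a, continuous (fun q => u (f q, g q))}.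
Proof.
by move=> su; apply: for_continuous_plane => //; exact: smooth_open_continuous su Ma.
Qed.

Lemma for_continuous_prolong1 :
  {for a, continuous (fun q => prolong1 omega Ups (f q, g q) (h q))}.
Proof.
have ct := for_continuous_smooth (smooth_pt sU).
have cx := for_continuous_smooth (smooth_px sU).
have dt := for_continuous_smooth (smooth_pt so).
have dx := for_continuous_smooth (smooth_px so).
exact: (for_continuousB (for_continuousD ct
  (for_continuousM (for_continuousB cx dt) ch))
  (for_continuousM dx (for_continuousX (n := 2) ch))).
Qed.

Lemma for_continuous_prolong2 :
  {for a, continuous (fun q => prolong2 omega Ups (f q, g q) (h q) (k q))}.
Proof.
have cx := for_continuous_smooth (smooth_px sU).
have dt := for_continuous_smooth (smooth_pt so).
have dx := for_continuous_smooth (smooth_px so).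
have ctt := for_continuous_smooth (smooth_pt (smooth_pt sU)).
have cxt := for_continuous_smooth (smooth_px (smooth_pt sU)).
have cxx := for_continuous_smooth (smooth_px (smooth_px sU)).
have dtt := for_continuous_smooth (smooth_pt (smooth_pt so)).
have dxt := for_continuous_smooth (smooth_px (smooth_pt so)).
have dxx := for_continuous_smooth (smooth_px (smooth_px so)).
have c2 := for_continuous_cst (k := 2); have c3 := for_continuous_cst (k := 3).
have C1 := for_continuousD ctt
  (for_continuousM (for_continuousB (for_continuousM c2 cxt) dtt) ch).
have C2 := for_continuousD C1 (for_continuousM
  (for_continuousB cxx (for_continuousM c2 dxt)) (for_continuousX (n := 2) ch)).
have C3 := for_continuousB C2 (for_continuousM dxx (for_continuousX (n := 3) ch)).
have C4 := for_continuousD C3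
  (for_continuousM (for_continuousB cx (for_continuousM c2 dt)) ck).
exact: (for_continuousB C4
  (for_continuousM (for_continuousM (for_continuousM c3 dx) ch) ck)).
Qed.

End Continuity.
End Boundary.

(** * The condition on the whole interval *)

(** The first and third coordinates move in [I] and its shift, where an endpoint may force the sign
    of [h]; the other five move in the open set [D]. Hence all seven partial derivatives of [F] are
    genuine limits, even at the boundary. *)
Lemma eq_dom_direction (R : realType) (r : R) (I D : set R) (a : arg_type R) :
  is_interval I -> (exists a b, [/\ I a, I b & a < b]) -> open D -> eq_dom r I D a ->
  forall e, List.In e [:: e_t R; e_x R; e_tr R; e_xr R; e_x1 R; e_x1r R; e_x2r R] ->
  forall eps : R, 0 < eps ->
    exists h : R, [/\ h != 0, `|h| < eps & eq_dom r I D (h *: e + a)].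
Proof.
case: a => [[[[[[t x] tr] xr] x1] x1r] x2r] iI nI oD.
move=> [[[[[[/= It Dx] [t' It' trE]] Dxr] Dx1] Dx1r] Dx2r].
have dir (v1 v2 v3 v4 v5 v6 v7 h : R) :
    I (h * v1 + t) -> D (h * v2 + x) -> shift_set I r (h * v3 + tr) ->
    D (h * v4 + xr) -> D (h * v5 + x1) -> D (h * v6 + x1r) -> D (h * v7 + x2r) ->
    eq_dom r I D (h *: ((v1, v2, v3, v4, v5, v6, v7) : arg_type R)
                  + (t, x, tr, xr, x1, x1r, x2r)) by move=> *; do 6?split.
have S3 : shift_set I r tr by exists t'.
have openD (y : R) : D y -> forall eps : R, 0 < eps ->
    exists h, [/\ h != 0, `|h| < eps & D (h + y)].
  move=> Dy eps eps0; have : nbhs y D by exact: open_nbhs_nbhs.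
  move=> /nbhs_ballP[q /= q0 Hq].
  have m0 : 0 < Num.min (eps / 2) (q / 2) by rewrite lt_min !divr_gt0.
  exists (Num.min (eps / 2) (q / 2)); split; first by rewrite gt_eqF.
    by rewrite gtr0_norm// gt_min; apply/orP; left; move: eps0; lra.
  apply: Hq; rewrite -ball_normE /= opprD addrCA subrr addr0 normrN gtr0_norm//.
  by rewrite gt_min; apply/orP; right; move: q0; lra.
move=> e ee eps eps0; move: ee.
move=> [<-|[<-|[<-|[<-|[<-|[<-|[<-|[]]]]]]]].
- have [h [h0 he Ih]] := interval_accumulation iI nI It eps0.
  by exists h; split => //; apply: dir; rewrite ?mulr0 ?mulr1 ?add0r// addrC.
- have [h [h0 he Ih]] := openD _ Dx _ eps0.
  by exists h; split => //; apply: dir; rewrite ?mulr0 ?mulr1 ?add0r.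
- have [h [h0 he Ih]] := interval_accumulation iI nI It' eps0.
  exists h; split => //; apply: dir; rewrite ?mulr0 ?mulr1 ?add0r//.
  by exists (t' + h) => //; rewrite -trE; ring.
- have [h [h0 he Ih]] := openD _ Dxr _ eps0.
  by exists h; split => //; apply: dir; rewrite ?mulr0 ?mulr1 ?add0r.
- have [h [h0 he Ih]] := openD _ Dx1 _ eps0.
  by exists h; split => //; apply: dir; rewrite ?mulr0 ?mulr1 ?add0r.
- have [h [h0 he Ih]] := openD _ Dx1r _ eps0.
  by exists h; split => //; apply: dir; rewrite ?mulr0 ?mulr1 ?add0r.
- have [h [h0 he Ih]] := openD _ Dx2r _ eps0.
  by exists h; split => //; apply: dir; rewrite ?mulr0 ?mulr1 ?add0r.
Qed.

(** All seven components of [q] are free variables here, so what remains for the limit is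
    convergence of the argument tuples. *)
Lemma invariance_condition_continuous (R : realType) (M : set (R * R))
    (omega Ups : R * R -> R) (U : set (arg_type R)) (G : arg_type R -> R) (a : arg_type R) :
  smooth_open M omega -> smooth_open M Ups -> smooth_open U G -> U a ->
  M (a.1.1.1.1.1.1, a.1.1.1.1.1.2) -> M (a.1.1.1.1.2, a.1.1.1.2) ->
  {for a, continuous (fun q => generator_terms omega Ups (fun e => 'D_e G q) q
     - prolong2 omega Ups (q.1.1.1.1.1.1, q.1.1.1.1.1.2) q.1.1.2 (G q))}.
Proof.
move=> so sU sG Ua Mp Mpr.
have cid : {for a, continuous (fun q : arg_type R => q)} by exact: cvg_id.
have c7 := for_continuous_snd cid.
have d6 := for_continuous_fst cid; have c6 := for_continuous_snd d6.
have d5 := for_continuous_fst d6; have c5 := for_continuous_snd d5.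
have d4 := for_continuous_fst d5; have c4 := for_continuous_snd d4.
have d3 := for_continuous_fst d4; have c3 := for_continuous_snd d3.
have d2 := for_continuous_fst d3; have c2 := for_continuous_snd d2.
have c1 := for_continuous_fst d2.
have cG := smooth_open_continuous sG Ua.
have cD e := smooth_open_continuous (smooth_open_derive e sG) Ua.
have o1 := for_continuous_smooth c1 c2 Mp so.
have u1 := for_continuous_smooth c1 c2 Mp sU.
have o2 := for_continuous_smooth c3 c4 Mpr so.
have u2 := for_continuous_smooth c3 c4 Mpr sU.
have p1 := for_continuous_prolong1 so sU c1 c2 c5 Mp.
have p1r := for_continuous_prolong1 so sU c3 c4 c6 Mpr.
have p2r := for_continuous_prolong2 so sU c3 c4 c6 c7 Mpr.
have p2 := for_continuous_prolong2 so sU c1 c2 c5 cG Mp.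
have S1 := for_continuousD (for_continuousM o1 (cD (e_t R)))
                           (for_continuousM u1 (cD (e_x R))).
have S2 := for_continuousD S1 (for_continuousM o2 (cD (e_tr R))).
have S3 := for_continuousD S2 (for_continuousM u2 (cD (e_xr R))).
have S4 := for_continuousD S3 (for_continuousM p1 (cD (e_x1 R))).
have S5 := for_continuousD S4 (for_continuousM p1r (cD (e_x1r R))).
have S6 := for_continuousD S5 (for_continuousM p2r (cD (e_x2r R))).
exact: (for_continuousB S6 p2).
Qed.

Unset Implicit Arguments.

Theorem theorem2p1 (R : realType) (r : R) (I D : set R) (F : arg_type R -> R)
    (M : set (R * R)) (W : set (R * R * R)) (f1 f2 : R * R -> R -> R)
    (omega Ups : R * R -> R) :
  0 < r ->
  is_interval I -> (exists a b, [/\ I a, I b & a < b]) ->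
  open D ->
  smooth_on (eq_dom r I D) F ->
  one_parameter_group M W f1 f2 ->
  sol_set I r `*` D `<=` M ->
  (forall p, M p -> omega p = derive1 (f1 p) 0) ->
  (forall p, M p -> Ups p = derive1 (f2 p) 0) ->
  smooth_open M omega -> smooth_open M Ups ->
  invariant_under r I D F f1 f2 ->
  forall x : R -> R, solution r I D F x ->
  forall t : R, I t ->
  let J := sol_set I r in
  let dF := fun e => partial_in (eq_dom r I D) F e (sol_args r J x t) in
  let x1 := der J x in
  let x2 := der J (der J x) in
  let p := (t, x t) in
  let pr := (t - r, x (t - r)) in
  omega p * dF (e_t R) + Ups p * dF (e_x R)
  + omega pr * dF (e_tr R) + Ups pr * dF (e_xr R)
  + prolong1 omega Ups p (x1 t) * dF (e_x1 R)
  + prolong1 omega Ups pr (x1 (t - r)) * dF (e_x1r R)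
  + prolong2 omega Ups pr (x1 (t - r)) (x2 (t - r)) * dF (e_x2r R)
  = pt (pt Ups) p + (2 * px (pt Ups) p - pt (pt omega) p) * x1 t
    + (px (px Ups) p - 2 * px (pt omega) p) * x1 t ^+ 2
    - px (px omega) p * x1 t ^+ 3
    + (px Ups p - 2 * pt omega p) * x2 t
    - 3 * px omega p * x1 t * x2 t.
Proof.
move=> r0 iI nI oD sF gr JDM Ho HU so sU inv x sol t It J dF x1 x2 p pr.
pose a := sol_args r J x t.
have [dx /(_ t It)[Aa Ea]] := sol.
(* One extension [G] on the open set [U] serves [a] and all nearby tuples, so the derivatives at an
   endpoint and at interior points come from the same function. *)
have [U [G [oU Ua sG GF]]] := sF a Aa.
have dFE e : List.In e [:: e_t R; e_x R; e_tr R; e_xr R; e_x1 R; e_x1r R; e_x2r R] ->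
    dF e = 'D_e G a.
  move=> ein; apply: (@derive_in_extension _ _ _ U) => //.
    exact: smooth_open_differentiable sG Ua.
  exact: (@eq_dom_direction _ _ _ _ _ iI nI oD Aa).
have JI (s : R) : I s -> J s /\ J (s - r).
  by move=> Is; split; [left|right; exists s].
have [Jt Jtr] := JI _ It.
have [[[[[[_ Dx] _] Dxr] _] _] _] := Aa.
have Mp : M p by exact: JDM.
have Mpr : M pr by exact: JDM.
have cPsi := @invariance_condition_continuous R M omega Ups U G a so sU sG Ua Mp Mpr.
set Psi := (X in {for a, continuous X}) in cPsi.
(* Interior points and endpoints are treated alike: a nonzero defect at [a] would persist near [a],
   against its vanishing at the tuple of a nearby interior time [tau]. *)
have Psi0 : Psi a = 0.
  apply: contrapT => /eqP; rewrite -normr_gt0 => Psi_gt0.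
  move/cvgrPdist_lt : cPsi => /(_ _ Psi_gt0) nPsi.
  have nU : nbhs a U by exact: open_nbhs_nbhs.
  have /nbhs_ballP[rho /= rho0 Hrho] : nbhs a [set q | `|Psi a - Psi q| < `|Psi a| /\ U q].
    exact: filterI.
  (* Differentiability of [x] and of its derivative makes four of the arguments continuous; the
     delayed second derivative is the only one for which [tau] has to be chosen specially. *)
  have [k1 k10 H1] := derivable_in_continuous (proj1 (dx _ Jt)) rho0.
  have [k2 k20 H2] := derivable_in_continuous (proj1 (dx _ Jtr)) rho0.
  have [k3 k30 H3] := derivable_in_continuous (proj2 (dx _ Jt)) rho0.
  have [k4 k40 H4] := derivable_in_continuous (proj2 (dx _ Jtr)) rho0.
  pose e := Num.min rho (Num.min (Num.min k1 k2) (Num.min k3 k4)).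
  have e0 : 0 < e by rewrite !lt_min rho0 k10 k20 k30.
  have [tau [nI' tau_e x2_e]] :=
    der_interior_approx iI nI It (fun s Js => proj2 (dx s Js)) e0.
  have Itau : I tau by exact: nbhs_singleton.
  have [Jtau Jtaur] := JI _ Itau.
  move: (tau_e); rewrite !lt_min => /andP[l0 /andP[/andP[l1 l2] /andP[l3 l4]]].
  move: (x2_e); rewrite !lt_min => /andP[l5 _].
  have sh : tau - r - (t - r) = tau - t by ring.
  have sh' : `|t - r - (tau - r)| < rho by rewrite distrC sh.
  have [|Psi_lt Utau] := Hrho (sol_args r J x tau).
    do 6?split; rewrite -ball_normE //=; try by rewrite distrC.
    - by rewrite distrC; exact: H1.
    - by rewrite distrC; apply: H2; rewrite ?sh.
    - by rewrite distrC; exact: H3.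
    - by rewrite distrC; apply: H4; rewrite ?sh.
  have := interior_invariance oD gr JDM Ho HU so sU inv sol nI' oU Utau
    (smooth_open_differentiable sG Utau) GF.
  move=> /eqP; rewrite -subr_eq0 => /eqP Psi_tau.
  by move: Psi_lt; rewrite [Psi (sol_args _ _ _ _)]Psi_tau subr0 ltxx.
(* The equation at [t] itself turns [G a] back into the second derivative, also when [t] is an
   endpoint. *)
have GE : G a = x2 t by rewrite GF.
move/eqP : Psi0; rewrite /Psi GE subr_eq0 => /eqP PsiE.
have D1 : dF (e_t R) = 'D_(e_t R) G a by apply: dFE; left.
have D2 : dF (e_x R) = 'D_(e_x R) G a by apply: dFE; right; left.
have D3 : dF (e_tr R) = 'D_(e_tr R) G a by apply: dFE; do 2 right; left.
have D4 : dF (e_xr R) = 'D_(e_xr R) G a by apply: dFE; do 3 right; left.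
have D5 : dF (e_x1 R) = 'D_(e_x1 R) G a by apply: dFE; do 4 right; left.
have D6 : dF (e_x1r R) = 'D_(e_x1r R) G a by apply: dFE; do 5 right; left.
have D7 : dF (e_x2r R) = 'D_(e_x2r R) G a by apply: dFE; do 6 right; left.
clearbody dF; rewrite D1 D2 D3 D4 D5 D6 D7.
exact: PsiE.
Qed.
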